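(* Let $\phi\in C_c^\infty(\mathbb{R}^n)$, $\int_{\mathbb{R}^n}\phi\,dx=1$, $\mathrm{supp}\,\phi\subseteq\overline{\mathbb{B}_n(0,1)}$. Let $w$ be a function from $]0,+\infty[$ to $[0,+\infty[$. Assume that there exists $r_0\in]0,+\infty[$ such that $w(r_0)\neq 0$. Then the following statements hold. (i) Let $p\in[1,+\infty[$. Let $$\sup_{r\in[\rho,+\infty[}w(r)<+\infty\qquad\forall\rho\in]0,+\infty[.\qquad( * )$$ If $f\in\mathcal{M}_p^{w,0}(\mathbb{R}^n)\cap L^p(\mathbb{R}^n)$, then $$f*\phi_\epsilon\in\mathcal{M}_p^{w,0}(\mathbb{R}^n)\cap L^p(\mathbb{R}^n)\cap C^\infty(\mathbb{R}^n)\cap C^0_{ub}(\mathbb{R}^n)$$ for all $\epsilon\in]0,+\infty[$ and $$\lim_{\epsilon\to 0}f*\phi_\epsilon=f\qquad\text{in }\mathcal{M}_p^{w,0}(\mathbb{R}^n)\cap L^p(\mathbb{R}^n).$$ (ii) Let $p\in[1,+\infty[$. Let condition $( * )$ hold. Set $X\equiv\mathcal{M}_p^w(\mathbb{R}^n)\cap L^p(\mathbb{R}^n)$. Then $$\mathrm{cl}_X\left(\mathcal{M}_p^{w,0}(\mathbb{R}^n)\cap L^p(\mathbb{R}^n)\cap C^\infty(\mathbb{R}^n)\cap C^0_{ub}(\mathbb{R}^n)\right)=\mathcal{M}_p^{w,0}(\mathbb{R}^n)\cap L^p(\mathbb{R}^n).$$ If we further assume that $$\lim_{\rho\to 0}\sup_{r\in]0,\rho]}w(r)r^{n/p}=0,$$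 then $$\mathrm{cl}_X\left(\mathcal{M}_p^{w,0}(\mathbb{R}^n)\cap L^p(\mathbb{R}^n)\cap C^\infty(\mathbb{R}^n)\cap C^0_{ub}(\mathbb{R}^n)\right)=\mathrm{cl}_X\left(\mathcal{M}_p^w(\mathbb{R}^n)\cap L^p(\mathbb{R}^n)\cap C^\infty(\mathbb{R}^n)\cap C^0_{ub}(\mathbb{R}^n)\right)$$ $$=\mathrm{cl}_X\left(\mathcal{M}_p^w(\mathbb{R}^n)\cap L^p(\mathbb{R}^n)\cap L^\infty(\mathbb{R}^n)\right)=\mathcal{M}_p^{w,0}(\mathbb{R}^n)\cap L^p(\mathbb{R}^n).$$
   Context: Here $n\geq 1$ is an integer, $]a,b[$ denotes an open interval, $\mathbb{B}_n(x,r)$ is the open Euclidean ball with center $x$ and radius $r$, and $L^p$ is with respect to Lebesgue measure. Functions are real valued and are identified when equal almost everywhere. $C^0_{ub}(\mathbb{R}^n)$ is the set of bounded uniformly continuous functions on $\mathbb{R}^n$. $\mathrm{cl}_XA$ is the closure of $A$ in the normed space $X$. For $t\in]0,+\infty[$, $\phi_t(x)\equiv t^{-n}\phi(x/t)$, and $f*\phi_\epsilon(x)\equiv\int_{\mathbb{R}^n}f(x-y)\phi_\epsilon(y)\,dy$. For $p\in[1,+\infty]$, a function $w:]0,+\infty[\to[0,+\infty[$, $\rho\in]0,+\infty]$ and a measurable $f:\mathbb{R}^n\to\mathbb{R}$, set $$|f|_{\rho,w,p,\mathbb{R}^n}\equiv\sup_{(x,r)\in\mathbb{R}^n\times]0,\rho[}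 w(r)\|f\|_{L^p(\mathbb{B}_n(x,r))}\in[0,+\infty]$$ (with $0\cdot(+\infty)=0$). If $w$ is not identically zero, the generalized Morrey space $\mathcal{M}_p^w(\mathbb{R}^n)$ is the set of measurable $f:\mathbb{R}^n\to\mathbb{R}$ with $|f|_{+\infty,w,p,\mathbb{R}^n}<+\infty$, normed by $\|f\|_{\mathcal{M}_p^w(\mathbb{R}^n)}\equiv|f|_{+\infty,w,p,\mathbb{R}^n}$. The vanishing generalized Morrey space is $$\mathcal{M}_p^{w,0}(\mathbb{R}^n)\equiv\{f\in\mathcal{M}_p^w(\mathbb{R}^n):\ \lim_{\rho\to 0}|f|_{\rho,w,p,\mathbb{R}^n}=0\},$$ endowed with the norm of $\mathcal{M}_p^w(\mathbb{R}^n)$. The intersections $\mathcal{M}_p^w(\mathbb{R}^n)\cap L^p(\mathbb{R}^n)$ and $\mathcal{M}_p^{w,0}(\mathbb{R}^n)\cap L^p(\mathbb{R}^n)$ are endowed with the norm $\max\{\|f\|_{\mathcal{M}_p^w(\mathbb{R}^n)},\|f\|_{L^p(\mathbb{R}^n)}\}$. *)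

(* Defs.v *)
From HB Require Import structures.
From mathcomp Require Import all_boot all_order all_algebra.
From mathcomp Require Import all_classical all_reals all_analysis.
Set Implicit Arguments.
Unset Strict Implicit.
Unset Printing Implicit Defensive.
Import Order.TTheory GRing.Theory Num.Theory.
Import numFieldNormedType.Exports.
Local Open Scope classical_set_scope.
Local Open Scope ring_scope.

(* The space R^n with n >= 1 is ['rV[R]_n.+1], with n shifted by one.  Its
   Lebesgue measure is the Caratheodory restriction of the Lebesgue outer
   measure, so that [measurable] means Lebesgue measurable on ['rV[R]_n.+1]. *)

Section lebesgue_outer_measure.
Context {R : realType} {n : nat}.
Local Notation V := 'rV[R]_n.+1.

Definition closed_box (ab : V * V) : set V :=
  [set x | forall i, ab.1 ord0 i <= x ord0 i <= ab.2 ord0 i].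

Definition box_volume (ab : V * V) : R :=
  \prod_(i < n.+1) (ab.2 ord0 i - ab.1 ord0 i).

Definition box_cover (A : set V) : set (nat -> V * V) :=
  [set Q : nat -> V * V |
     (forall k i, (Q k).1 ord0 i <= (Q k).2 ord0 i) /\
     A `<=` \bigcup_k closed_box (Q k)].

Local Open Scope ereal_scope.

Definition lebesgue_outer (A : set V) : \bar R :=
  ereal_inf [set \sum_(k <oo) (box_volume (Q k))%:E | Q in box_cover A].

Lemma box_volume_ge0 A Q k : box_cover A Q -> 0 <= (box_volume (Q k))%:E.
Proof.
by move=> [Q0 _]; rewrite lee_fin; apply: prodr_ge0 => i _; rewrite subr_ge0.
Qed.

Lemma lebesgue_outer_ge0 A : 0 <= lebesgue_outer A.
Proof.
apply: le_ereal_inf_tmp => _ [Q AQ <-]; apply: nneseries_ge0 => k _ _.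
exact: box_volume_ge0 AQ.
Qed.

Lemma lebesgue_outer0 : lebesgue_outer set0 = 0.
Proof.
apply/eqP; rewrite eq_le lebesgue_outer_ge0 andbT.
apply: ereal_inf_lbound; exists (fun=> (0%R, 0%R)); first by split.
apply: eseries0 => k _ _; rewrite /box_volume big_ord_recl !mxE subrr.
by rewrite mul0r.
Qed.

Lemma le_lebesgue_outer : {homo lebesgue_outer : A B / A `<=` B >-> A <= B}.
Proof.
move=> A B AB; apply: ereal_inf_le_tmp => x [Q [Q0 BQ] <-].
by exists Q => //; split=> //; exact: subset_trans BQ.
Qed.

Lemma lebesgue_outer_sigma_subadditive : sigma_subadditive lebesgue_outer.
Proof.
move=> A; have [[i ioo]|] := pselect (exists i, lebesgue_outer (A i) = +oo).
  rewrite (eseries_pinfty _ _ ioo) ?leey// => k _.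
  by rewrite -ltNye (lt_le_trans _ (lebesgue_outer_ge0 _)).
rewrite -forallNE => Aoo.
suff add2e (e : {posnum R}) : lebesgue_outer (\bigcup_k A k) <=
    \sum_(i <oo) lebesgue_outer (A i) + e%:num%:E.
  by apply/lee_addgt0Pr => _/posnumP[].
rewrite (le_trans _ (epsilon_trick _ _ _))//; last first.
  by move=> k; exact: lebesgue_outer_ge0.
pose vol (ab : V * V) := (box_volume ab)%:E.
pose P k (Q : nat -> V * V) := box_cover (A k) Q /\ \sum_(j <oo) vol (Q j) <=
  lebesgue_outer (A k) + (e%:num / (2 ^ k.+1)%:R)%:E.
have [G PG] : {G : nat -> nat -> V * V & forall k, P k (G k)}.
  apply: (@choice _ _ P) => k; rewrite /P.
  have fA : lebesgue_outer (A k) \is a fin_num.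
    by rewrite ge0_fin_numE ?lebesgue_outer_ge0// ltey; apply/eqP/Aoo.
  have ek1 : (0 < e%:num / (2 ^ k.+1)%:R)%R by [].
  have [_ [Q AQ <-] lt_Q] := lb_ereal_inf_adherent ek1 fA.
  by exists Q; split => //; exact: ltW.
have vol0 (x : nat * nat) : 0 <= (vol \o uncurry G) x.
  by case: x => i j; exact: box_volume_ge0 (PG i).1.
apply: (@le_trans _ _ (\esum_(i in setT) (vol \o uncurry G) i)).
  apply: ereal_inf_lbound => /=.
  have /card_esym/ppcard_eqP[f] := card_nat2.
  exists (uncurry G \o f).
    split => [k i|t [i _ Ait]].
      by rewrite /=; case: (f k) => j l; exact: (PG j).1.1.
    have [j _ Gt] := (PG i).1.2 t Ait; exists (f^-1%FUN (i, j)) => //=.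
    by rewrite invK ?inE.
  rewrite -(esum_pred_image (vol \o uncurry G) _ xpredT) ?[fun=> _]set_true//.
  by rewrite image_eq.
rewrite (_ : esum _ _ = \sum_(i <oo) \sum_(j <oo) vol (G i j)); last first.
  pose J : nat -> set (nat * nat) := fun i => [set (i, j) | j in setT].
  rewrite (_ : setT = \bigcup_k J k); last first.
    by rewrite predeqE => -[a b]; split => // _; exists a => //; exists b.
  rewrite esum_bigcupT /=; last 2 first.
    - apply/trivIsetP => i j _ _ ij.
      rewrite predeqE => -[k m] /=; split => //= -[] [_] _ [<-{k} _].
      by move=> [m' _] [] /esym/eqP; rewrite (negbTE ij).
    - exact: vol0.
  rewrite -(image_id [set: nat]) -fun_true esum_pred_image//; last first.
    by move=> k _; apply: esum_ge0 => ? _; exact: vol0.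
  apply: eq_eseriesr => /= j _.
  rewrite -(esum_pred_image (vol \o uncurry G) (pair j) predT).
  - congr (esum _ _); rewrite predeqE => -[a b].
    by split=> -[i _ <-]; exists i.
  - by move=> i _; exact: vol0.
  - by move=> ? ? _ _; exact: (@can_inj _ _ _ snd).
apply: lee_nneseries => k _; last exact: (PG k).2.
by move=> *; apply: nneseries_ge0 => m *; exact: (vol0 (k, m)).
Qed.

HB.instance Definition _ := isOuterMeasure.Build R V lebesgue_outer
  lebesgue_outer0 lebesgue_outer_ge0 le_lebesgue_outer
  lebesgue_outer_sigma_subadditive.

HB.instance Definition _ := @isMeasurable.Build
  (caratheodory_display lebesgue_outer) V lebesgue_outer.-caratheodory
  (caratheodory_measurable_set0 lebesgue_outer)
  (@caratheodory_measurable_setC _ _ lebesgue_outer)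
  (@caratheodory_measurable_bigcup _ _ lebesgue_outer).

Definition lebesgue : set V -> \bar R := lebesgue_outer.

HB.instance Definition _ := isMeasure.Build _ V R lebesgue
  (@caratheodory_measure0 R V lebesgue_outer)
  (@caratheodory_measure_ge0 R V lebesgue_outer)
  (@caratheodory_measure_sigma_additive R V lebesgue_outer).

End lebesgue_outer_measure.

Section function_spaces.
Context {R : realType} {n : nat}.
Local Notation V := 'rV[R]_n.+1.
Implicit Types (f g phi : V -> R) (w : R -> R) (p rho : \bar R).

(* The library norm on [V] is the sup norm: it gives the topology and the
   uniformity of R^n, but not its Euclidean balls. *)
Definition enorm (x : V) : R := Num.sqrt (\sum_(i < n.+1) x ord0 i ^+ 2).

Definition eball (x : V) (r : R) : set V := [set y | enorm (y - x) < r].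

Definition unit_vector (i : 'I_n.+1) : V := delta_mx ord0 i.

Fixpoint Ck (k : nat) f : Prop :=
  continuous f /\
  if k is k'.+1 then
    forall i, (forall x, derivable f x (unit_vector i)) /\
              Ck k' ('D_(unit_vector i) f)
  else True.

Definition Cinfty : set (V -> R) := [set f | forall k, Ck k f].

Definition fsupp f : set V := closure [set x | f x != 0].

Definition Cc_infty : set (V -> R) :=
  [set f | Cinfty f /\ compact (fsupp f)].

Definition C0ub : set (V -> R) :=
  [set f | bounded_fun f /\ unif_continuous f].

Definition dilate phi (t : R) : V -> R :=
  fun x => t ^- n.+1 * phi (t^-1 *: x).

Definition convolution f g : V -> R :=
  fun x => \int[lebesgue]_y (f (x - y) * g y).

Local Open Scope ereal_scope.

Definition Lp p : set (V -> R) := [set f | f \in Lfun lebesgue p].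

Definition Lp_norm p f : \bar R := 'N[lebesgue]_p[EFin \o f].

(* The norm of [f] in L^p(D) is that of its extension by zero outside [D]. *)
Definition Lp_norm_on (D : set V) p f : \bar R := Lp_norm p (f \_ D).

(* |f|_{rho,w,p}; only the values of [w] on ]0, +oo[ are used.  The product of
   [\bar R] satisfies 0 * +oo = 0. *)
Definition morrey_sup rho w p f : \bar R :=
  ereal_sup [set z | exists x : V, exists r : R,
    [/\ (0 < r)%R, r%:E < rho & z = (w r)%:E * Lp_norm_on (eball x r) p f]].

Definition morrey_norm w p f : \bar R := morrey_sup +oo w p f.

(* Spaces of functions identified almost everywhere are represented by the sets
   of all their representatives. *)
Definition morrey w p : set (V -> R) :=
  [set f | measurable_fun setT f /\ morrey_norm w p f < +oo].

Definition vanishing_morrey w p : set (V -> R) :=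
  [set f | morrey w p f /\
           morrey_sup rho%:E w p f @[rho --> (0:R)^'+] --> 0].

Definition morrey_Lp_norm w p f : \bar R :=
  maxe (morrey_norm w p f) (Lp_norm p f).

(* Closure in X, the intersection of [morrey w p] and [Lp p].  Distances do not
   see null sets: the closure of [A] is the same whether [A] is a set of
   functions or the set of their almost everywhere classes. *)
Definition closure_morrey_Lp w p (A : set (V -> R)) : set (V -> R) :=
  [set f | (morrey w p `&` Lp p) f /\
    forall e : R, (0 < e)%R ->
      exists2 g, A g & morrey_Lp_norm w p (f \- g)%R < e%:E].

End function_spaces.

(* Main.v *)
Require Import Defs.
From HB Require Import structures.
From mathcomp Require Import all_boot all_order all_algebra.
From mathcomp Require Import all_classical all_reals all_analysis.
From mathcomp Require Import measurable_realfun ess_sup_inf.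
From mathcomp Require Import ring lra.
Set Implicit Arguments.
Unset Strict Implicit.
Unset Printing Implicit Defensive.
Import Order.TTheory GRing.Theory Num.Theory.
Import numFieldNormedType.Exports.
Local Open Scope classical_set_scope.
Local Open Scope ring_scope.

(** Write [S_rho f] for the local Morrey seminorm [morrey_sup rho w p f].
    Minkowski's integral inequality on each ball, together with translation
    invariance, gives [S_rho (f * K) <= ||K||_1 S_rho f].  For vanishing [f] this
    makes the seminorm of [f * phi_e - f] over small radii small, uniformly in
    [e]; over the radii [r >= rho] the weight is bounded, so that part is at most
    a constant times [||f * phi_e - f||_p], which tends to 0.  Hence mollification
    converges in the Morrey norm, which gives density; conversely the vanishing
    condition is closed under Morrey norm limits.  Under the extra condition on
    [w], a function that is bounded almost everywhere is vanishing because
    [||f||_{L^p(B(x, r))} <= ||f||_oo (2 r)^(n/p)]. *)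

(** * Lebesgue measure on row vectors *)

Section lebesgue_measure_rV.
Context {R : realType} {n : nat}.
Local Notation V := 'rV[R]_n.+1.
Local Notation mu := (@lebesgue R n).

Local Open Scope ereal_scope.

(** Measurability shapes the route. The sigma-algebra consists of all Lebesgue measurable sets, so
    for a general [f] in L^p Tonelli's theorem cannot be applied directly to [f (x - y)].
    Minkowski's inequality is therefore proved first for a dense class, [nice], and reaches [f]
    through L^p approximation and Fatou's lemma. Members of that class are also bounded, of bounded
    support and continuous almost everywhere, so their mollifications converge by dominated
    convergence, with no detour through continuous functions of compact support. Minkowski's
    inequality is needed only with one bound [b] for all translates; in this form it follows from
    Hoelder's inequality for the weight [|K|] and Tonelli's theorem, without duality. The measure of
    a box is only bounded above by its volume, never computed: every estimate needs an upper bound,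
    and the normalization comes from the integral of [phi]. Euclidean balls enter only through
    measurability, translation and inclusion in a cube of the sup norm. *)

Lemma lebesgue_closed_box_le (ab : V * V) :
  (forall i, ab.1 ord0 i <= ab.2 ord0 i)%R ->
  mu (closed_box ab) <= (box_volume ab)%:E.
Proof.
move=> ab0.
(* The padding boxes [(0, 0)] have volume 0 because the dimension [n.+1] gives the product at least
   one factor. *)
pose Q k : V * V := if k is 0%N then ab else (0%R, 0%R).
have Q0 : forall k, (0 <= k)%N -> 0 <= (box_volume (Q k))%:E.
  move=> k _; rewrite lee_fin; apply: prodr_ge0 => i _.
  by case: k => [|k]/=; rewrite subr_ge0.
apply: (@le_trans _ _ (\sum_(k <oo) (box_volume (Q k))%:E)).
  apply: ereal_inf_lbound; exists Q => //; split; first by case=> [|k] i /=.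
  by move=> x abx; exists 0%N.
rewrite (nneseries_split 0%N 1%N) => [|k _]; last exact: Q0.
rewrite add0n big_nat1 eseries0 ?adde0// => k k1 _.
case: k k1 => //= k _; rewrite /box_volume big_ord_recl !mxE subrr.
by rewrite mul0r.
Qed.

Definition set_coord (x : V) (i : 'I_n.+1) (c : R) : V :=
  \row_j if j == i then c else x ord0 j.

(* The hyperplane cuts every box of a cover into two boxes with the same total
   volume. *)
Lemma closed_half_space_measurable (i : 'I_n.+1) (a : R) :
  measurable [set x : V | (x ord0 i <= a)%R].
Proof.
apply: le_caratheodory_measurable => X.
set H := [set x : V | _].
apply: le_ereal_inf_tmp => _ [Q [Q0 XQ] <-].
(* [c k] is [a] clamped to the [i]-th side of [Q k]: when the hyperplane misses the box, one piece
   is degenerate and both are still admissible boxes. *)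
pose c k := Num.min (Num.max a ((Q k).1 ord0 i)) ((Q k).2 ord0 i).
pose Q1 k : V * V := ((Q k).1, set_coord (Q k).2 i (c k)).
pose Q2 k : V * V := (set_coord (Q k).1 i (c k), (Q k).2).
have c1 k : ((Q k).1 ord0 i <= c k <= (Q k).2 ord0 i)%R.
  by rewrite /c le_min le_max lexx orbT Q0 ge_min lexx orbT.
have vol_split k : (box_volume (Q k) = box_volume (Q1 k) + box_volume (Q2 k))%R.
  have volE (ab : V * V) : (box_volume ab = (ab.2 ord0 i - ab.1 ord0 i) *
      \prod_(j < n.+1 | j != i) (ab.2 ord0 j - ab.1 ord0 j))%R.
    by rewrite /box_volume (bigD1 i).
  rewrite !volE/= !mxE eqxx.
  have E1 : (\prod_(j < n.+1 | j != i) (set_coord (Q k).2 i (c k) ord0 j - (Q k).1 ord0 j) =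
      \prod_(j < n.+1 | j != i) ((Q k).2 ord0 j - (Q k).1 ord0 j))%R.
    by apply: eq_bigr => j ji; rewrite !mxE (negbTE ji).
  have E2 : (\prod_(j < n.+1 | j != i) ((Q k).2 ord0 j - set_coord (Q k).1 i (c k) ord0 j) =
      \prod_(j < n.+1 | j != i) ((Q k).2 ord0 j - (Q k).1 ord0 j))%R.
    by apply: eq_bigr => j ji; rewrite !mxE (negbTE ji).
  by rewrite [in RHS]E1 [in RHS]E2 -mulrDl; congr (_ * _)%R; ring.
have ord1 k j : ((Q1 k).1 ord0 j <= (Q1 k).2 ord0 j)%R.
  by rewrite /= mxE; case: eqP => [->|_ //]; have /andP[] := c1 k.
have ord2 k j : ((Q2 k).1 ord0 j <= (Q2 k).2 ord0 j)%R.
  by rewrite /= mxE; case: eqP => [->|_ //]; have /andP[] := c1 k.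
have vol1 k : (0 <= k)%N -> true -> 0 <= (box_volume (Q1 k))%:E.
  by move=> _ _; rewrite lee_fin; apply: prodr_ge0 => j _; rewrite subr_ge0.
have vol2 k : (0 <= k)%N -> true -> 0 <= (box_volume (Q2 k))%:E.
  by move=> _ _; rewrite lee_fin; apply: prodr_ge0 => j _; rewrite subr_ge0.
under eq_eseriesr do rewrite vol_split EFinD.
rewrite nneseriesD//; apply: leeD.
  apply: ereal_inf_lbound; exists Q1 => //; split=> // x [Xx Hx].
  have [k _ Qx] := XQ _ Xx; exists k => // j.
  have /andP[xl xu] := Qx j; rewrite xl/= mxE; case: eqP => // ji.
  by move: Hx xl xu; rewrite /H/= ji /c le_min le_max => -> _ ->.
apply: ereal_inf_lbound; exists Q2 => //; split=> // x [Xx /negP Hx].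
have [k _ Qx] := XQ _ Xx; exists k => // j.
have /andP[xl xu] := Qx j; rewrite xu andbT mxE; case: eqP => // ji.
move: Hx xl xu; rewrite -ltNge ji => ax xl xu.
by rewrite ge_min ge_max (ltW ax) xl.
Qed.

Lemma measurable_coord (i : 'I_n.+1) :
  measurable_fun setT (fun x : V => x ord0 i).
Proof.
apply: (measurability (@RGenOInfty.G R)) => [|/= _ [_] [r] -> <-].
  exact: RGenOInfty.measurableE.
rewrite setTI; rewrite [X in measurable X](_ : _ = ~` [set x : V | (x ord0 i <= r)%R]).
  by apply: measurableC; exact: closed_half_space_measurable.
apply/seteqP; split=> x /=; rewrite in_itv/= andbT ltNge.
  by move=> /negP.
by move=> /negP.
Qed.

Lemma ball_measurable_rV (x : V) (e : R) : measurable (ball x e : set V).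
Proof.
have [e0|e0] := ltP 0%R e; last first.
  rewrite [X in measurable X](_ : _ = set0)//.
  by apply/seteqP; split=> // y [/lt_le_trans/(_ e0)]; rewrite ltxx.
rewrite [X in measurable X](_ : _ =
    \bigcap_(i in [set: 'I_n.+1]) ((fun y : V => y ord0 i) @^-1` ball (x ord0 i) e)).
  apply: fin_bigcap_measurable => // i _.
  rewrite -[X in measurable X]setTI; apply: measurable_coord => //.
  exact: measurable_ball.
apply/seteqP; split=> y.
  by move=> [_ xy] i _; exact: xy.
move=> xy; split=> // i j; rewrite !ord1.
by have := xy j I.
Qed.

Lemma rV_ball_ratr (x : V) (e : R) : (0 < e)%R ->
  exists q : 'rV[rat]_n.+1, ball x e (map_mx ratr q : V).
Proof.
move=> e0.
have /fin_all_exists[q xq] : forall i : 'I_n.+1,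
    exists q : rat, ball (x ord0 i) e (ratr q).
  move=> i.
  have xe : (x ord0 i - e < x ord0 i + e)%R.
    by rewrite ltrBlDr -addrA ltrDl addr_gt0.
  by have [q xqe] := rat_in_itvoo xe; exists q; rewrite ball_itv.
exists (\row_i q i); split=> // i j; rewrite !ord1 !mxE; exact: xq.
Qed.

(** The balls of rational centre and radius [1 / k.+1] contained in [A] are countably many and
    exhaust it. Borel sets are thus Lebesgue measurable, whence the measurability of continuous
    functions. *)
Lemma open_measurable_rV (A : set V) : open A -> measurable A.
Proof.
move=> oA.
pose B (u : 'rV[rat]_n.+1 * nat) : set V := ball (map_mx ratr u.1 : V) (u.2.+1%:R^-1)%R.
rewrite (_ : A = \bigcup_(u in [set u | B u `<=` A]) B u).
  rewrite bigcup_mkcond; apply: countable_bigcupT_measurable => // u.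
  by case: ifPn => // _; exact: ball_measurable_rV.
apply/seteqP; split=> [x Ax|x [u BA Bu]]; last exact: BA.
have /nbhs_ballP[e /= e0 xeA] : nbhs x A by exact: open_nbhs_nbhs.
(* Half of [e]: a ball of this radius that contains [x] stays within two radii of [x]. *)
have [k ke] : exists k : nat, (k.+1%:R^-1 < e / 2)%R.
  have [k _ ke] := near_infty_natSinv_lt (PosNum (divr_gt0 e0 (ltr0n _ 2))).
  by exists k; exact: (ke k (leqnn k)).
have k0 : (0 < k.+1%:R^-1 :> R)%R by rewrite invr_gt0.
have [q xq] := rV_ball_ratr x k0.
exists (q, k); last exact: ball_sym.
move=> y /= By; apply: xeA; rewrite (splitr e).
apply: ball_triangle; first by apply: le_ball xq; exact: ltW.
by apply: le_ball By; exact: ltW.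
Qed.

Lemma continuous_measurable_rV (f : V -> R) :
  continuous f -> measurable_fun setT f.
Proof.
move=> cf; apply: (measurability (@RGenOInfty.G R)) => [|/= _ [_] [a ->] <-].
  exact: RGenOInfty.measurableE.
rewrite setTI; apply: open_measurable_rV.
by move/continuousP : cf; apply; exact: interval_open.
Qed.

Lemma closed_box_measurable (ab : V * V) : measurable (closed_box ab).
Proof.
rewrite [X in measurable X](_ : _ = \bigcap_(i in [set: 'I_n.+1])
   ((fun y : V => y ord0 i) @^-1` `[ab.1 ord0 i, ab.2 ord0 i])).
  apply: fin_bigcap_measurable => // i _.
  by rewrite -[X in measurable X]setTI; apply: measurable_coord.
apply/seteqP; split=> y.
  by move=> yab i _; rewrite /= in_itv/=; exact: yab.
by move=> yab i; have := yab i I; rewrite /= in_itv.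
Qed.

Let affine (x : V) (s : R) (y : V) : V := (x + s *: y)%R.

Let affineK x s : (s != 0)%R ->
  cancel (affine x s) (affine (- (s^-1 *: x))%R s^-1%R).
Proof.
move=> s0 y; rewrite /affine scalerDr addrA addNr add0r scalerA mulVf// scale1r //.
Qed.

Let affineKV x s : (s != 0)%R ->
  cancel (affine (- (s^-1 *: x))%R s^-1%R) (affine x s).
Proof.
move=> s0 y; rewrite /affine scalerDr scalerN !scalerA mulfV// !scale1r addrA.
by rewrite subrr add0r.
Qed.

(** A box cover of [A] is pulled back along the affine map, which scales every volume by the same
    factor. The reverse inequality is this one for the inverse map. *)
Let lebesgue_outer_affine_le (x : V) (s : R) (A : set V) : (s != 0)%R ->
  lebesgue_outer (affine x s @^-1` A) <= (`|s| ^- n.+1)%:E * lebesgue_outer A.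
Proof.
move=> s0.
have c0 : (0 < `|s| ^- n.+1)%R by rewrite invr_gt0 exprn_gt0// normr_gt0.
rewrite -lee_pdivrMl//; apply: le_ereal_inf_tmp => _ [Q [Q0 AQ] <-].
rewrite lee_pdivrMl//.
(* A negative [s] reverses the order on each coordinate, so the corners are exchanged. *)
pose P k : V * V := if (0 < s)%R
  then (s^-1 *: ((Q k).1 - x), s^-1 *: ((Q k).2 - x))%R
  else (s^-1 *: ((Q k).2 - x), s^-1 *: ((Q k).1 - x))%R.
have vol k : (box_volume (P k) = `|s| ^- n.+1 * box_volume (Q k))%R.
  have -> : (`|s| ^- n.+1 = \prod_(i < n.+1) `|s|^-1)%R.
    by rewrite prodr_const card_ord exprVn.
  rewrite /box_volume -big_split/=; apply: eq_bigr => i _; rewrite /P.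
  case: ltP => [s0'|s0']; rewrite /= !mxE -mulrBr.
    by rewrite gtr0_norm//; congr (_ * _)%R; rewrite opprB addrA subrK.
  by rewrite ler0_norm// invrN mulNr -mulrN; congr (_ * _)%R; ring.
rewrite -nneseriesZl//; last first.
  by move=> k _; rewrite lee_fin; apply: prodr_ge0 => i _; rewrite subr_ge0.
under [X in _ <= X]eq_eseriesr do rewrite -EFinM -vol.
apply: ereal_inf_lbound; exists P => //; split.
  move=> k i; rewrite /P; case: ltP => [s0'|s0']; rewrite /= !mxE.
    by rewrite ler_pM2l ?invr_gt0// lerD2r.
  by rewrite ler_nM2l ?invr_lt0 ?lt_neqAle ?s0// lerD2r.
move=> y /AQ[k _ yQ]; exists k => // i.
have := yQ i; rewrite /affine !mxE /P; case: ltP => [s0'|s0']; rewrite /= !mxE.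
  by rewrite ler_pdivrMl// ler_pdivlMl// lerBlDl lerBrDl.
have s0'' : (s < 0)%R by rewrite lt_neqAle s0.
by rewrite ler_ndivrMl// ler_ndivlMl// lerBlDl lerBrDl andbC.
Qed.

Let lebesgue_outer_affine (x : V) (s : R) (A : set V) : (s != 0)%R ->
  lebesgue_outer (affine x s @^-1` A) = (`|s| ^- n.+1)%:E * lebesgue_outer A.
Proof.
move=> s0; apply/eqP; rewrite eq_le lebesgue_outer_affine_le//=.
have c0 : (0 < `|s| ^- n.+1)%R by rewrite invr_gt0 exprn_gt0// normr_gt0.
rewrite -lee_pdivlMl//.
have := @lebesgue_outer_affine_le (- (s^-1 *: x))%R s^-1%R (affine x s @^-1` A).
rewrite invr_eq0 normfV -exprVn invrK => /(_ s0).
by rewrite -comp_preimage (_ : affine x s \o _ = id) ?invrK//; last exact/funext/affineKV.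
Qed.

(** Continuity would cover Borel sets only. For a Lebesgue measurable [A] the Caratheodory criterion
    is transported: every test set [X] is the preimage of some [Y], and all outer measures scale by
    the same constant. *)
Lemma measurable_affine (x : V) (s : R) : (s != 0)%R ->
  measurable_fun setT (fun y : V => (x + s *: y)%R).
Proof.
move=> s0 _ A mA; rewrite setTI; apply: le_caratheodory_measurable => X.
have c0 : (0 < `|s| ^- n.+1)%R by rewrite invr_gt0 exprn_gt0// normr_gt0.
have [Y ->] : exists Y, X = affine x s @^-1` Y.
  exists (affine (- (s^-1 *: x))%R s^-1%R @^-1` X).
  by rewrite -comp_preimage (_ : _ \o _ = id)//; exact/funext/affineK.
change (lebesgue_outer (affine x s @^-1` (Y `&` A)) +
  lebesgue_outer (affine x s @^-1` (Y `&` ~` A)) <= lebesgue_outer (affine x s @^-1` Y)).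
rewrite !lebesgue_outer_affine//.
by rewrite -ge0_muleDr ?lebesgue_outer_ge0// -mA.
Qed.

Lemma lebesgue_affine (x : V) (s : R) (A : set V) : (s != 0)%R ->
  mu ((fun y => x + s *: y)%R @^-1` A) = (`|s| ^- n.+1)%:E * mu A.
Proof. exact: lebesgue_outer_affine. Qed.

(** Makes Tonelli's theorem available on [V * V]; the exhausting sets are cubes centred at 0. *)
Lemma lebesgue_sigma_finite : sigma_finite setT mu.
Proof.
exists (fun k => closed_box (- const_mx k%:R, const_mx k%:R)%R).
  apply/esym; rewrite -subTset => x _.
  have [k xk] : exists k : nat, (`|x| <= k%:R)%R.
    by exists (Num.bound `|x|); exact/ltW/archi_boundP.
  exists k => // i; rewrite !mxE -ler_norml; apply: le_trans xk.
  by rewrite [leRHS]mx_normrE; apply: (le_bigmax _ (fun ij => `|x ij.1 ij.2|%R) (ord0, i)).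
move=> k; split; first exact: closed_box_measurable.
rewrite (le_lt_trans (lebesgue_closed_box_le _)) ?ltry// => i.
by rewrite !mxE ge0_cp.
Qed.

HB.instance Definition _ := @Measure_isSigmaFinite.Build _ V R mu lebesgue_sigma_finite.

End lebesgue_measure_rV.

(** * L^p norms *)

Section Lnorm_extra.
Context d {T : measurableType d} {R : realType}.
Variable mu : {measure set T -> \bar R}.
Variable p : R.
Hypothesis p1 : 1 <= p.
Implicit Types (f g : T -> R) (D : set T).
Local Notation "'N[ f ]" := (Lnorm mu p%:E (EFin \o f)).

Let p0 : 0 < p. Proof. exact: lt_le_trans p1. Qed.

Local Open Scope ereal_scope.

Lemma measurable_abs_powR f : measurable_fun setT f ->
  measurable_fun setT (fun x => (`|f x| `^ p)%:E).
Proof.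
move=> mf; apply/measurable_EFinP.
apply: (@measurableT_comp _ _ _ _ _ _ (@powR R ^~ p)) => //.
exact: measurableT_comp.
Qed.

Lemma Lnorm_integral f : 'N[f] = (\int[mu]_x (`|f x| `^ p)%:E) `^ p^-1.
Proof.
by rewrite unlock; congr (_ `^ _); apply: eq_integral => x _; rewrite /= poweR_EFin.
Qed.

Lemma integral_Lnorm f : \int[mu]_x (`|f x| `^ p)%:E = 'N[f] `^ p.
Proof.
by rewrite poweR_Lnorm ?gt_eqF.
Qed.

(** The almost everywhere form serves essentially bounded functions, whose bound may fail on a null
    set. *)
Lemma le_Lnorm_ae f g : measurable_fun setT f -> measurable_fun setT g ->
  {ae mu, forall x, (`|f x| <= `|g x|)%R} -> 'N[f] <= 'N[g].
Proof.
move=> mf mg fg; rewrite !Lnorm_integral.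
have p0' : (0 <= p^-1)%R by rewrite invr_ge0 ltW.
apply: (gt0_ler_poweR p0').
- by rewrite in_itv/= leey andbT integral_ge0// => x _; rewrite lee_fin powR_ge0.
- by rewrite in_itv/= leey andbT integral_ge0// => x _; rewrite lee_fin powR_ge0.
apply: ae_ge0_le_integral => //=.
- exact: measurable_abs_powR.
- exact: measurable_abs_powR.
- by apply: filterS fg => x fgx _; rewrite lee_fin ge0_ler_powR// ltW.
Qed.

Lemma le_Lnorm f g : measurable_fun setT f -> measurable_fun setT g ->
  (forall x, `|f x| <= `|g x|)%R -> 'N[f] <= 'N[g].
Proof. by move=> mf mg fg; apply: le_Lnorm_ae => //; exact: nearW. Qed.

Lemma abs_eq_Lnorm f g : (forall x, `|f x| = `|g x|)%R -> 'N[f] = 'N[g].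
Proof.
by move=> fg; rewrite !Lnorm_integral; under eq_integral do rewrite fg.
Qed.

Lemma Lnorm_subC f g : 'N[(f \- g)%R] = 'N[(g \- f)%R].
Proof. by apply: abs_eq_Lnorm => x /=; rewrite distrC. Qed.

Lemma measurable_patch f D : measurable D -> measurable_fun setT f ->
  measurable_fun setT (f \_ D).
Proof.
by move=> mD mf; apply/(measurable_restrictT _ mD).1; exact: measurable_funTS.
Qed.

Lemma Lnorm_restrict_le f D : measurable D -> measurable_fun setT f ->
  'N[f \_ D] <= 'N[f].
Proof.
move=> mD mf; apply: le_Lnorm => //; first exact: measurable_patch.
by move=> x; rewrite /patch; case: ifPn => // _; rewrite normr0.
Qed.

Lemma integral_abs_powR_restrict f D :
  \int[mu]_x (`|(f \_ D) x| `^ p)%:E = \int[mu]_(x in D) (`|f x| `^ p)%:E.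
Proof.
rewrite [RHS]integral_mkcond; apply: eq_integral => x _; rewrite /patch.
by case: ifPn => // _; rewrite normr0 powR0// gt_eqF.
Qed.

(** Hoelder's inequality against [\1_D]: the constant is the L^q norm of [\1_D] for the conjugate
    exponent [q], or 1 when [p = 1] and [q] would be infinite. *)
Lemma integral_le_Lnorm D : measurable D -> mu D < +oo ->
  exists2 C : R, (0 <= C)%R & forall f, measurable_fun setT f ->
    \int[mu]_(x in D) `|f x|%:E <= C%:E * 'N[f].
Proof.
move=> mD Doo.
have Dfin : mu D \is a fin_num by rewrite ge0_fin_numE.
have normE f : \int[mu]_(x in D) `|f x|%:E = \int[mu]_x `|(f x * \1_D x)%:E|.
  rewrite integral_mkcond; apply: eq_integral => x _.
  rewrite /patch indicE; case: ifPn => [xD|xD]; first by rewrite mulr1.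
  by rewrite mulr0 abse0.
move: p1; rewrite le_eqVlt => /predU1P[p1'|p1'].
  exists 1%R => // f mf; rewrite mul1e Lnorm_integral -p1' invr1 poweRe1; last first.
    by apply: integral_ge0 => x _; rewrite lee_fin powR_ge0.
  rewrite integral_mkcond ge0_le_integral//=.
  - by move=> x _; rewrite /patch; case: ifP => // _; rewrite lee_fin.
  - apply/(measurable_restrictT _ _).1 => //; apply: measurable_funTS.
    by apply/measurable_EFinP; exact: measurableT_comp.
  - by rewrite p1'; exact: measurable_abs_powR.
  - move=> x _; rewrite /patch; case: ifP => // _; first by rewrite powRr1.
    by rewrite lee_fin powR_ge0.
pose q := (p / (p - 1))%R.
have q0 : (0 < q)%R by rewrite divr_gt0// subr_gt0.
have pq : (p^-1 + q^-1 = 1)%R.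
  by rewrite /q invf_div -{1}(div1r p) -mulrDl subrKC mulfV// gt_eqF.
exists (fine (Lnorm mu q%:E (EFin \o \1_D))).
  exact/fine_ge0/Lnorm_ge0.
move=> f mf.
have := hoelder mu mf (measurable_indic mD) p0 q0 pq.
rewrite Lnorm1 normE => /le_trans; apply.
rewrite muleC fineK// unlock fin_num_poweR//.
rewrite (eq_integral (fun x => (\1_D x)%:E)); last first.
  move=> x _; rewrite /= indicE.
  by case: (x \in D); rewrite ?normr1 ?powR1// normr0 powR0// gt_eqF.
by rewrite integral_indic// setIT.
Qed.

End Lnorm_extra.

(** * Affine changes of variables in Lebesgue integrals *)

Section affine_change_of_variables.
Context {R : realType} {n : nat}.
Local Notation V := 'rV[R]_n.+1.
Local Notation mu := (@lebesgue R n).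
Local Open Scope ereal_scope.

(** The push-forward of [mu] under the affine map is [mu] scaled by [|s| ^- n.+1]. *)
Lemma ge0_integral_affine (x : V) (s : R) (F : V -> \bar R) : (s != 0)%R ->
  measurable_fun setT F -> (forall y, 0 <= F y) ->
  \int[mu]_y F (x + s *: y)%R = (`|s| ^- n.+1)%:E * \int[mu]_y F y.
Proof.
move=> s0 mF F0; have mh := measurable_affine x s0.
have c0 : (0 <= `|s| ^- n.+1)%R by rewrite invr_ge0 exprn_ge0.
have := ge0_integral_pushforward mh mu measurableT mF (fun y _ => F0 y).
rewrite preimage_setT => <-.
rewrite -[RHS](ge0_integral_mscale _ _ (NngNum c0))//.
apply: eq_measure_integral => // A mA _.
exact: lebesgue_affine.
Qed.

Lemma integrable_affine (x : V) (s : R) (F : V -> \bar R) : (s != 0)%R ->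
  mu.-integrable setT F -> mu.-integrable setT (fun y : V => F (x + s *: y)%R).
Proof.
move=> s0 /integrableP[mF Foo]; have mh := measurable_affine x s0.
apply/integrableP; split; first exact: measurableT_comp.
have maF : measurable_fun setT (fun y => `|F y|) by exact: measurableT_comp.
rewrite (ge0_integral_affine x s0 maF) => [|//].
by rewrite lte_mul_pinfty// lee_fin invr_ge0 exprn_ge0.
Qed.

Lemma integral_affine (x : V) (s : R) (F : V -> \bar R) : (s != 0)%R ->
  mu.-integrable setT F ->
  \int[mu]_y F (x + s *: y)%R = (`|s| ^- n.+1)%:E * \int[mu]_y F y.
Proof.
move=> s0 iF; have mF := measurable_int mu iF.
rewrite integralE [in RHS]integralE.
have -> : \int[mu]_y (fun z : V => F (x + s *: z)%R)^\+ y =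
    (`|s| ^- n.+1)%:E * \int[mu]_y F^\+ y.
  rewrite (funepos_comp F (fun z : V => x + s *: z)%R).
  exact: (ge0_integral_affine x s0 (measurable_funepos mF) (funepos_ge0 F)).
have -> : \int[mu]_y (fun z : V => F (x + s *: z)%R)^\- y =
    (`|s| ^- n.+1)%:E * \int[mu]_y F^\- y.
  rewrite (funeneg_comp F (fun z : V => x + s *: z)%R).
  exact: (ge0_integral_affine x s0 (measurable_funeneg mF) (funeneg_ge0 F)).
apply/esym/muleBr => //; apply: fin_num_adde_defl.
by rewrite fin_numN; exact: integrable_neg_fin_num.
Qed.

End affine_change_of_variables.

(** * Convolution with a continuous kernel of bounded support *)

Section convolution_smoothing.
Context {R : realType} {n : nat}.
Local Notation V := 'rV[R]_n.+1.
Local Notation mu := (@lebesgue R n).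
Implicit Types (f g K psi : V -> R) (rho M : R).

Lemma coord_norm_le (x : V) i : `|x ord0 i| <= `|x|.
Proof.
by rewrite [leRHS]mx_normrE; apply: (le_bigmax _ (fun ij => `|x ij.1 ij.2|) (ord0, i)).
Qed.

Lemma rV_norm_le (x : V) rho : 0 <= rho ->
  (forall i, `|x ord0 i| <= rho) -> `|x| <= rho.
Proof.
move=> rho0 xrho; rewrite [leLHS]mx_normrE; apply/bigmax_leP; split=> // -[i j] _ /=.
by rewrite ord1.
Qed.

(** Kernel supports and Euclidean balls are enclosed in such sets, which are at once compact and
    boxes of explicit volume. *)
Definition cube rho : set V := [set y | `|y| <= rho].

Lemma cube_closed_box rho : 0 <= rho ->
  cube rho = closed_box (- const_mx rho, const_mx rho).
Proof.
move=> rho0; apply/seteqP; split=> x /=.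
  by move=> xr i; rewrite !mxE -ler_norml (le_trans (coord_norm_le x i)).
by move=> xr; apply: rV_norm_le => // i; have := xr i; rewrite !mxE -ler_norml.
Qed.

Lemma cube_lt0 rho : rho < 0 -> cube rho = set0.
Proof.
move=> rho0; rewrite -subset0 => x /= /le_lt_trans/(_ rho0).
by rewrite normr_lt0.
Qed.

Lemma measurable_cube rho : measurable (cube rho).
Proof.
have [rho0|rho0] := leP 0 rho; last by rewrite cube_lt0.
by rewrite cube_closed_box//; exact: closed_box_measurable.
Qed.

Lemma lebesgue_cube_le rho : 0 <= rho ->
  (mu (cube rho) <= ((2 * rho) ^+ n.+1)%:E)%E.
Proof.
move=> rho0; rewrite cube_closed_box//; apply: (le_trans (lebesgue_closed_box_le _)).
  by move=> i; rewrite !mxE ge0_cp.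
rewrite lee_fin /box_volume (eq_bigr (fun=> 2 * rho)); last first.
  by move=> i _; rewrite !mxE/= opprK mulr2n mulrDl mul1r.
by rewrite prodr_const card_ord.
Qed.

Lemma lebesgue_cube_lty rho : (mu (cube rho) < +oo)%E.
Proof.
have [rho0|rho0] := leP 0 rho; last by rewrite cube_lt0// measure0.
by rewrite (le_lt_trans (lebesgue_cube_le rho0))// ltry.
Qed.

Lemma compact_cube rho : compact (cube rho).
Proof.
apply: bounded_closed_compact.
  by exists rho; split; [exact: num_real|move=> M rM x /= xr; exact: le_trans (ltW rM)].
rewrite (_ : cube rho = (fun x : V => `|x|) @^-1` [set t | t <= rho])//.
by apply: closed_comp; [move=> x _; exact: norm_continuous|exact: closed_le].
Qed.

Lemma subr_affineE (x : V) : (fun y => x - y) = (fun y => x + (-1) *: y).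
Proof. by apply/funext => y; rewrite scaleN1r. Qed.

Lemma measurable_subl (x : V) : measurable_fun setT (fun y : V => x - y).
Proof. by rewrite subr_affineE; apply: measurable_affine; rewrite oppr_eq0 oner_eq0. Qed.

Lemma measurable_fun_subl f (x : V) : measurable_fun setT f ->
  measurable_fun setT (fun y : V => f (x - y)).
Proof.
by move=> mf; apply: (measurableT_comp mf); exact: measurable_subl.
Qed.

Lemma measurable_fun_subr f (x : V) : measurable_fun setT f ->
  measurable_fun setT (fun y : V => f (y - x)).
Proof.
move=> mf; apply: (measurableT_comp mf).
rewrite (_ : (fun y : V => y - x) = (fun y => - x + 1 *: y)).
  by apply: measurable_affine; rewrite oner_eq0.
by apply/funext => y; rewrite scale1r addrC.
Qed.

Lemma ge0_integral_subl (x : V) (F : V -> \bar R) :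
  measurable_fun setT F -> (forall y, (0 <= F y)%E) ->
  (\int[mu]_y F (x - y)%R = \int[mu]_y F y)%E.
Proof.
move=> mF F0; have N1 : -1 != 0 :> R by rewrite oppr_eq0 oner_eq0.
have := ge0_integral_affine x N1 mF F0.
rewrite normrN1 expr1n invr1 mul1e => <-.
by apply: eq_integral => y _; rewrite scaleN1r.
Qed.

Lemma ge0_integral_subr (x : V) (F : V -> \bar R) :
  measurable_fun setT F -> (forall y, (0 <= F y)%E) ->
  (\int[mu]_y F (y - x)%R = \int[mu]_y F y)%E.
Proof.
move=> mF F0; have N1 : 1 != 0 :> R by rewrite oner_eq0.
have := ge0_integral_affine (- x) N1 mF F0.
rewrite normr1 expr1n invr1 mul1e => <-.
by apply: eq_integral => y _; rewrite scale1r addrC.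
Qed.

Lemma near0_norm_lt1 : \forall h \near (0 : V), `|h| < 1.
Proof.
apply/nbhs_ballP; exists 1 => //= h.
by rewrite -ball_normE /ball_ /= sub0r normrN.
Qed.

Lemma continuous_bounded_support psi rho : continuous psi ->
  (forall y, rho < `|y| -> psi y = 0) -> exists M, forall y, `|psi y| <= M.
Proof.
move=> cpsi psi0.
have : compact (psi @` cube rho).
  apply: continuous_compact; last exact: compact_cube.
  exact: continuous_subspaceT.
move=> /compact_bounded[N [Nreal HN]].
exists (Num.max 0 (N + 1)) => y; rewrite le_max.
have [yr|yr] := leP `|y| rho; last by rewrite psi0// normr0 lexx.
by apply/orP; right; apply: HN; [rewrite ltrDl|exists y].
Qed.

(** On [cube (rho + 1)] this is uniform continuity on a compact set; outside it, [psi] vanishes both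
    at [y] and at [y + h] as soon as [|h| < 1]. *)
Lemma unif_small_translation psi rho : continuous psi ->
  (forall y, rho < `|y| -> psi y = 0) ->
  forall e, 0 < e -> \forall h \near (0 : V), forall y, `|psi (y + h) - psi y| <= e.
Proof.
move=> cpsi psi0 e e0.
have key (x : V) : \forall xh \near nbhs (x, (0 : V)),
    `|psi (xh.1 + xh.2) - psi xh.1| <= e.
  have e2 : 0 < e / 2 by rewrite divr_gt0.
  have cx : (fun xh : V * V => psi (xh.1 + xh.2)) @ nbhs (x, (0 : V)) --> psi x.
    rewrite -[in X in _ --> X](addr0 x).
    by apply: (@cvg_comp _ _ _ (fun xh : V * V => xh.1 + xh.2) psi _ _ _ _ (cpsi _));
      exact: (@add_continuous _ (x, 0)).
  have cx1 : (fun xh : V * V => psi xh.1) @ nbhs (x, (0 : V)) --> psi x.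
    by apply: (@cvg_comp _ _ _ (fun xh : V * V => xh.1) psi _ _ _ cvg_fst (cpsi _)).
  have H1 : \forall xh \near nbhs (x, (0 : V)), `|psi x - psi (xh.1 + xh.2)| <= e / 2.
    by move/cvgrPdist_le : cx; apply.
  have H2 : \forall xh \near nbhs (x, (0 : V)), `|psi x - psi xh.1| <= e / 2.
    by move/cvgrPdist_le : cx1; apply.
  near=> xh.
  rewrite (splitr e) (le_trans (ler_distD (psi x) _ _))// lerD//.
    by rewrite distrC; near: xh.
  by near: xh.
have cov : \forall h \near (0 : V), forall y, cube (rho + 1) y ->
    `|psi (y + h) - psi y| <= e.
  (* The near-covering form of compactness merges the neighbourhoods given by [key] into one
     neighbourhood of [h = 0] valid for every [y] in the cube. *)
  have /compact_near_coveringP ncov := @compact_cube (rho + 1).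
  apply: (ncov V (nbhs (0 : V)) (fun h y => `|psi (y + h) - psi y| <= e)
    (nbhs_filter _)) => x _.
  exact: key.
near=> h.
have h1 : `|h| < 1 by near: h; exact: near0_norm_lt1.
have hcov : forall y, cube (rho + 1) y -> `|psi (y + h) - psi y| <= e by near: h.
move=> y; have [yr|yr] := leP `|y| (rho + 1); first exact: hcov.
rewrite !psi0 ?subrr ?normr0 ?ltW//; first by apply: lt_trans yr; rewrite ltrDl.
rewrite -(ltrD2r 1) (lt_le_trans yr)//.
rewrite -{1}(addrK h y) (le_trans (ler_normB _ _))// lerD2l ltW//.
Unshelve. all: by end_near. Qed.

Lemma line_derive1 psi (v : V) : (forall x, derivable psi x v) ->
  forall (y : V) (t : R), is_derive t 1 (fun t : R => psi (y + t *: v)) ('D_v psi (y + t *: v)).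
Proof.
move=> dpsi y t; apply: DeriveDef.
  have := dpsi (y + t *: v); rewrite /derivable.
  set F := (X in cvg (X @ _) -> _); set G := (X in _ -> cvg (X @ _)).
  suff -> : G = F by [].
  apply/funext => h; rewrite /F /G /= -[h%:A]/(h * 1) mulr1 scalerDl.
  by rewrite addrCA.
rewrite /derive.
set F := (X in lim (X @ _) = _); set G := (X in _ = lim (X @ _)).
suff -> : F = G by [].
apply/funext => h; rewrite /F /G /= -[h%:A]/(h * 1) mulr1 scalerDl.
by rewrite addrCA.
Qed.

(** By the mean value theorem along the line [y + t *: v], the quotient equals the directional
    derivative at some [y + c *: v] with [|c| <= |h|]. *)
Lemma difference_quotient_bound psi (v : V) (h e : R) y :
  (forall x, derivable psi x v) -> h != 0 ->
  (forall t, `|t| <= `|h| -> `|'D_v psi (y + t *: v) - 'D_v psi y| <= e) ->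
  `|h^-1 * (psi (y + h *: v) - psi y) - 'D_v psi y| <= e.
Proof.
move=> dpsi h0 he; have dg := line_derive1 dpsi y.
have cg : continuous (fun t : R => psi (y + t *: v)).
  by move=> t; apply: differentiable_continuous; apply/derivable1_diffP; have [] := dg t.
have [c ch E] : exists2 c, `|c| <= `|h| &
    psi (y + h *: v) - psi y = 'D_v psi (y + c *: v) * h.
  have [h00|h00] := leP 0 h.
    have [c] := MVT_segment h00 (fun t _ => dg t) (continuous_subspaceT cg).
    rewrite in_itv/= => /andP[c0 ch] E; exists c; first by rewrite !ger0_norm.
    by rewrite scale0r addr0 subr0 in E.
  have [c] := MVT_segment (ltW h00) (fun t _ => dg t) (continuous_subspaceT cg).
  rewrite in_itv/= => /andP[c0 ch] E; exists c.
    by rewrite !ler0_norm// ?lerN2// ltW.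
  by move: E; rewrite scale0r addr0 sub0r mulrN => /(congr1 -%R); rewrite opprB opprK.
by rewrite E mulrCA mulVf// mulr1; exact: he.
Qed.

Section Lp_convolution.
Variable p : R.
Hypothesis p1 : 1 <= p.
Local Notation LP := (@Lp R n p%:E).
Local Notation NP f := (Lp_norm p%:E f).

Lemma LpP f : LP f <-> measurable_fun setT f /\ (NP f < +oo)%E.
Proof.
rewrite /Lp /= inE; split=> [/andP[]|[mf fp]].
  by rewrite !inE.
by apply/andP; rewrite !inE.
Qed.

Lemma Lp_norm_ge0 f : (0 <= NP f)%E.
Proof. exact: Lnorm_ge0. Qed.

Lemma Lp_norm_fin_num f : LP f -> NP f \is a fin_num.
Proof. by move=> /LpP[_ fp]; rewrite ge0_fin_numE ?Lp_norm_ge0. Qed.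

Lemma Lp_norm_subl f (x : V) : measurable_fun setT f ->
  NP (fun y => f (x - y)) = NP f.
Proof.
move=> mf; rewrite /Lp_norm !Lnorm_integral.
by rewrite -[in RHS](ge0_integral_subl x (measurable_abs_powR p mf)).
Qed.

(** Hoelder's inequality on [cube rho] for [f (x - y)], whose L^p norm in [y] is that of [f] for
    every [x]. As [C] depends on the support radius only, a kernel that is uniformly small gives a
    convolution that is uniformly small; continuity and differentiability of convolutions rest on
    this. *)
Lemma convolution_bound rho : exists2 C, 0 <= C &
  forall f K M, LP f -> measurable_fun setT K -> (forall y, `|K y| <= M) ->
    (forall y, rho < `|y| -> K y = 0) -> forall x,
    mu.-integrable setT (fun y : V => (f (x - y) * K y)%:E) /\
    `|convolution f K x| <= M * C * fine (NP f).
Proof.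
have [C C0 HC] := integral_le_Lnorm p1 (measurable_cube rho) (lebesgue_cube_lty rho).
exists C => // f K M fp mK KM Krho x.
have /LpP[mf _] := fp.
have M0 : 0 <= M := le_trans (normr_ge0 _) (KM 0).
have mfx := measurable_fun_subl x mf.
have mG : measurable_fun setT (fun y : V => (f (x - y) * K y)%:E).
  by apply/measurable_EFinP; exact: measurable_funM.
have mabs : measurable_fun setT (fun y : V => `|f (x - y)|).
  exact: (measurableT_comp (@normr_measurable R setT) mfx).
have mMabs : measurable_fun setT (fun y : V => M * `|f (x - y)|).
  exact: (measurable_funM (measurable_cst M) mabs).
have bound : (\int[mu]_y `|(f (x - y) * K y)%:E| <= (M * C * fine (NP f))%:E)%E.
  rewrite [in X in (_ <= X)%E]EFinM EFinM fineK ?Lp_norm_fin_num//.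
  rewrite -(Lp_norm_subl x mf) -muleA.
  apply: (@le_trans _ _ (M%:E * \int[mu]_(y in cube rho) `|f (x - y)|%:E)%E); last first.
    by rewrite lee_wpmul2l ?lee_fin// HC.
  rewrite -ge0_integralZl//; last 2 first.
  - exact: measurable_cube.
  - by apply/measurable_EFinP; exact: measurable_funTS.
  rewrite [leRHS]integral_mkcond; apply: ge0_le_integral => //.
  - exact: (measurableT_comp (@abse_measurable R setT) mG).
  - apply/(measurable_restrictT _ (measurable_cube rho)).1.
    by apply: measurable_funTS; exact/measurable_EFinP.
  - move=> y _; rewrite /patch; case: ifPn => yrho.
      by rewrite -EFinM lee_fin normrM mulrC ler_wpM2r.
    rewrite Krho ?mulr0 ?abse0// ltNge; apply: contra yrho.
    by rewrite inE.
have iG : mu.-integrable setT (fun y : V => (f (x - y) * K y)%:E).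
  by apply/integrableP; split => //; rewrite (le_lt_trans bound)// ltry.
split=> //; rewrite /convolution.
apply: (le_trans (le_normr_Rintegral _ _)) => //.
rewrite -lee_fin; apply: le_trans bound.
rewrite /Rintegral fineK//.
have := iG => /integrable_abse/integrable_fin_num; exact.
Qed.

Lemma convolutionB f K L (x : V) :
  mu.-integrable setT (fun y : V => (f (x - y) * K y)%:E) ->
  mu.-integrable setT (fun y => (f (x - y) * L y)%:E) ->
  convolution f (K \- L) x = convolution f K x - convolution f L x.
Proof.
move=> iK iL; rewrite /convolution -RintegralB//.
by apply: eq_Rintegral => y _; rewrite mulrBr.
Qed.

Lemma convolutionZ f K (a : R) (x : V) :
  mu.-integrable setT (fun y : V => (f (x - y) * K y)%:E) ->
  convolution f (fun y => a * K y) x = a * convolution f K x.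
Proof.
move=> iK; rewrite /convolution -RintegralZl//.
by apply: eq_Rintegral => y _; rewrite mulrCA.
Qed.

Lemma convolutionBl f g K (x : V) :
  mu.-integrable setT (fun y : V => (f (x - y) * K y)%:E) ->
  mu.-integrable setT (fun y => (g (x - y) * K y)%:E) ->
  convolution (f \- g) K x = convolution f K x - convolution g K x.
Proof.
move=> iK iL; rewrite /convolution -RintegralB//.
by apply: eq_Rintegral => y _; rewrite mulrBl.
Qed.

(** The substitution [y + h] for [y] moves the translation from [f], which has no regularity, to the
    kernel. *)
Lemma convolution_translate f K (x h : V) :
  mu.-integrable setT (fun y => (f (x + h - y) * K y)%:E) ->
  convolution f K (x + h) = convolution f (fun y => K (y + h)) x.
Proof.
move=> iK; rewrite /convolution /Rintegral; congr fine.
have N1 : 1 != 0 :> R by rewrite oner_eq0.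
have := integral_affine h N1 iK.
rewrite normr1 expr1n invr1 mul1e => <-.
apply: eq_integral => y _; rewrite scale1r.
by rewrite opprD addrA -[(x + h) - h]addrA subrr addr0 [h + y]addrC.
Qed.

Lemma convolution_unif_small f psi rho : LP f -> continuous psi ->
  (forall y, rho < `|y| -> psi y = 0) ->
  forall e, 0 < e -> \forall h \near (0 : V), forall x,
    `|convolution f psi (x + h) - convolution f psi x| <= e.
Proof.
move=> fp cpsi psi0 e e0.
(* The radius grows by 1 to hold the supports of [psi] and of its translates by [|h| < 1]. *)
have [C C0 HC] := convolution_bound (rho + 1).
have [M psiM] := continuous_bounded_support cpsi psi0.
have mpsi := continuous_measurable_rV cpsi.
have N0 : 0 <= C * fine (NP f) by rewrite mulr_ge0// fine_ge0 ?Lp_norm_ge0.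
(* A kernel bounded by [d] has a convolution bounded by [d * C * fine (NP f) <= e]; the added 1
   keeps the denominator positive. *)
pose d := e / (C * fine (NP f) + 1).
have d0 : 0 < d by rewrite divr_gt0// ltr_wpDl.
near=> h => x.
have h1 : `|h| < 1 by near: h; exact: near0_norm_lt1.
have hd : forall y, `|psi (y + h) - psi y| <= d.
  by near: h; exact: (unif_small_translation cpsi psi0).
have rho1 y : rho + 1 < `|y| -> rho < `|y|.
  by apply: lt_trans; rewrite ltrDl.
have psih0 y : rho + 1 < `|y| -> psi (y + h) = 0.
  move=> yr; apply: (psi0 (y + h)); rewrite -(ltrD2r 1) (lt_le_trans yr)//.
  by rewrite -{1}(addrK h y) (le_trans (ler_normB _ _))// lerD2l ltW.
have mpsih : measurable_fun setT (fun y : V => psi (y + h)).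
  by have := measurable_fun_subr (- h) mpsi; rewrite opprK.
have psi1 y : rho + 1 < `|y| -> psi y = 0 by move=> /rho1; exact: psi0.
have i1 z := (HC f psi M fp mpsi psiM psi1 z).1.
have i2 z := (HC f (fun y => psi (y + h)) M fp mpsih (fun y => psiM _) psih0 z).1.
rewrite convolution_translate// -convolutionB//.
have mB : measurable_fun setT ((fun y : V => psi (y + h)) \- psi).
  exact: measurable_funB.
have /(_ fp mB hd) := HC f ((fun y : V => psi (y + h)) \- psi) d.
case/(_ _ x) => [y yr|_ /le_trans]; first by rewrite /= psih0// psi1// subrr.
apply; rewrite /d -mulrA mulrAC ler_pdivrMr ?ltr_wpDl//.
by rewrite ler_wpM2l ?(ltW e0)// lerDl.
Unshelve. all: by end_near. Qed.

Lemma convolution_C0ub f psi rho : LP f -> continuous psi ->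
  (forall y, rho < `|y| -> psi y = 0) -> C0ub (convolution f psi).
Proof.
move=> fp cpsi psi0; split.
  have [C C0 HC] := convolution_bound rho.
  have [M psiM] := continuous_bounded_support cpsi psi0.
  have mpsi := continuous_measurable_rV cpsi.
  exists (M * C * fine (NP f)); split; first exact: num_real.
  move=> N MN x _ /=; apply: le_trans (ltW MN).
  exact: (HC f psi M fp mpsi psiM psi0 x).2.
rewrite /unif_continuous => A; rewrite -entourage_ballE => -[e /= e0 eA].
have e2 : 0 < e / 2 by rewrite divr_gt0.
have /nbhs_ballP[d /= d0 dH] := convolution_unif_small fp cpsi psi0 e2.
rewrite -entourage_ballE; exists d => //= -[x y] /= xy.
apply: eA => /=; rewrite -ball_normE /ball_ /=.
rewrite -[in X in `|X|](subrK x y) [y - x + x]addrC.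
apply: (@le_lt_trans _ _ (e / 2)); last first.
  by rewrite ltr_pdivrMr// ltr_pMr// ltr1n.
rewrite distrC; apply: dH.
by move: xy; rewrite -!ball_normE /ball_ /= sub0r normrN distrC.
Qed.

Lemma convolution_continuous f psi rho : LP f -> continuous psi ->
  (forall y, rho < `|y| -> psi y = 0) -> continuous (convolution f psi).
Proof.
move=> fp cpsi psi0 x A /nbhs_ballP[e /= e0 eA].
have e2 : 0 < e / 2 by rewrite divr_gt0.
have /nbhs_ballP[d /= d0 dH] := convolution_unif_small fp cpsi psi0 e2.
apply/nbhs_ballP; exists d => //= y xy; apply: eA.
rewrite -ball_normE /ball_ /=; apply: (@le_lt_trans _ _ (e / 2)); last first.
  by rewrite ltr_pdivrMr// ltr_pMr// ltr1n.
rewrite -[in X in `|X|](subrK x y) [y - x + x]addrC distrC; apply: dH.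
by move: xy; rewrite -!ball_normE /ball_ /= sub0r normrN distrC.
Qed.

End Lp_convolution.

End convolution_smoothing.

(** * Derivatives of convolutions and of dilated kernels *)

Section convolution_derivatives.
Context {R : realType} {n : nat}.
Local Notation V := 'rV[R]_n.+1.
Local Notation mu := (@lebesgue R n).
Implicit Types (f psi : V -> R) (rho : R).

Lemma derive_bounded_support psi rho (v : V) :
  (forall y : V, rho < `|y| -> psi y = 0) ->
  forall y : V, rho < `|y| -> 'D_v psi y = 0.
Proof.
move=> psi0 y yr; rewrite (@near_eq_derive _ _ _ psi (cst 0)); first exact: derive_cst.
have d0 : 0 < `|y| - rho by rewrite subr_gt0.
apply/nbhs_ballP; exists (`|y| - rho) => //= z; rewrite -ball_normE /ball_ /= => yz.
apply: psi0; rewrite -(ltrD2l (`|y - z| - rho)).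
have := ler_normD (y - z) z; rewrite subrK => yzz.
by lra.
Qed.

(** Only a directional derivative is assumed, so the chain rule is checked on quotients: the one
    with increment [h] is [c * s] times that of [psi] at [s *: x] with increment [s * h], which
    stays nonzero. *)
Lemma derive_affine psi (v x : V) (c s : R) : s != 0 -> derivable psi (s *: x) v ->
  is_derive x v (fun z : V => c * psi (s *: z)) (c * s * 'D_v psi (s *: x)).
Proof.
move=> s0 dpsi; set D := 'D_v psi (s *: x).
suff H : h^-1 *: (((fun z : V => c * psi (s *: z)) \o shift x) (h *: v)
     - c * psi (s *: x)) @[h --> 0^'] --> c * s * D.
  by apply: DeriveDef; [apply/cvg_ex; exists (c * s * D)|exact: cvg_lim H].
have {}dpsi : h^-1 *: ((psi \o shift (s *: x)) (h *: v) - psi (s *: x))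
    @[h --> 0^'] --> D by exact: dpsi.
have sh : s * h @[h --> (0 : R)^'] --> 0^'.
  move=> A [e /= e0 eA].
  suff : \forall h \near (0 : R)^', A (s * h) by [].
  near=> h; apply: eA => /=.
    rewrite sub0r normrN normrM -ltr_pdivlMl ?normr_gt0// mulrC.
    by near: h; apply: dnbhs0_lt; rewrite divr_gt0// normr_gt0.
  by rewrite mulf_neq0//; near: h; exact: nbhs_dnbhs_neq.
have := @cvgM _ _ _ _ (cst (c * s)) _ _ _ (cvg_cst (c * s)) (cvg_comp _ _ sh dpsi).
move=> /(_ _ _); apply: cvg_trans; apply: near_eq_cvg; near=> h => /=.
have h0 : h != 0 by near: h; exact: nbhs_dnbhs_neq.
rewrite -mulrBr -![_ *: (_ : R)]/(_ * _) scalerDr scalerA mulrA.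
by rewrite [RHS]mulrCA mulrA; congr (_ * _); field; rewrite s0 h0.
Unshelve. all: by end_near. Qed.

Section Lp.
Variable p : R.
Hypothesis p1 : 1 <= p.
Local Notation LP := (@Lp R n p%:E).

(** The quotient of [convolution f psi] minus the expected derivative is itself a convolution
    [convolution f K], where [K] is the error of the difference quotient of [psi]. The mean value
    theorem and the uniform continuity of ['D_v psi] make [K] uniformly small. *)
Lemma convolution_derive f psi rho (v : V) : LP f -> continuous psi ->
  (forall x, derivable psi x v) -> continuous ('D_v psi) ->
  (forall y : V, rho < `|y| -> psi y = 0) ->
  forall x, is_derive x v (convolution f psi) (convolution f ('D_v psi) x).
Proof.
move=> fp cpsi dpsi cD psi0 x; set D := 'D_v psi.
suff H : h^-1 *: ((convolution f psi \o shift x) (h *: v) - convolution f psi x)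
    @[h --> 0^'] --> convolution f D x.
  by apply: DeriveDef; [apply/cvg_ex; exists (convolution f D x)|exact: cvg_lim H].
have [C C0 HC] := convolution_bound (n := n) p1 (rho + 1).
have D0 := derive_bounded_support v psi0.
have [M psiM] := continuous_bounded_support cpsi psi0.
have [N DN] := continuous_bounded_support cD D0.
have mpsi := continuous_measurable_rV cpsi.
have mD := continuous_measurable_rV cD.
have N0 : 0 <= C * fine (Lp_norm p%:E f) by rewrite mulr_ge0// fine_ge0 ?Lp_norm_ge0.
have rho1 (y : V) : rho + 1 < `|y| -> rho < `|y|.
  by apply: lt_trans; rewrite ltrDl.
apply/cvgrPdist_le => e e0.
pose d := e / (C * fine (Lp_norm p%:E f) + 1).
have d0 : 0 < d by rewrite divr_gt0// ltr_wpDl.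
have : \forall k \near (0 : V), (forall y, `|D (y + k) - D y| <= d) /\ `|k| < 1.
  near=> k; split; last by near: k; exact: near0_norm_lt1.
  near: k; exact: (unif_small_translation cD D0).
move=> /nbhs_ballP[r /= r0 Hr].
(* Adding 1 allows a division by this bound even for [v = 0]. *)
have v0 : 0 < `|v| + 1 by rewrite ltr_wpDl.
near=> h.
have h0 : h != 0 by near: h; exact: nbhs_dnbhs_neq.
have hr (t : R) : `|t| <= `|h| -> ball (0 : V) r (t *: v).
  move=> th; rewrite -ball_normE /ball_ /= sub0r normrN normrZ.
  apply: (@le_lt_trans _ _ (`|h| * (`|v| + 1))).
    by rewrite ler_pM// lerDl.
  rewrite -ltr_pdivlMr//; near: h; apply: dnbhs0_lt; exact: divr_gt0.
pose K (y : V) := h^-1 * (psi (y + h *: v) - psi y) - D y.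
have [_ hv1] := Hr _ (hr h (lexx _)).
have psih0 (y : V) : rho + 1 < `|y| -> psi (y + h *: v) = 0.
  move=> yr; apply: (psi0 (y + h *: v)); rewrite -(ltrD2r 1) (lt_le_trans yr)//.
  by rewrite -{1}(addrK (h *: v) y) (le_trans (ler_normB _ _))// lerD2l ltW.
have mpsih : measurable_fun setT (fun y : V => psi (y + h *: v)).
  by have := measurable_fun_subr (- (h *: v)) mpsi; rewrite opprK.
have psi1 (y : V) : rho + 1 < `|y| -> psi y = 0 by move=> /rho1; exact: (psi0 y).
have D1 (y : V) : rho + 1 < `|y| -> D y = 0 by move=> /rho1; exact: (D0 y).
have i1 z := (HC f psi M fp mpsi psiM psi1 z).1.
have i2 z := (HC f (fun y => psi (y + h *: v)) M fp mpsih (fun y => psiM _) psih0 z).1.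
have i3 z := (HC f D N fp mD DN D1 z).1.
have mdiff : measurable_fun setT (fun y : V => psi (y + h *: v) - psi y).
  exact: (measurable_funB mpsih mpsi).
have bdiff (y : V) : `|psi (y + h *: v) - psi y| <= M + M.
  by rewrite (le_trans (ler_normB _ _))// lerD.
have sdiff (y : V) : rho + 1 < `|y| -> psi (y + h *: v) - psi y = 0.
  by move=> yr; rewrite psih0// psi1// subrr.
have i4 z := (HC f _ (M + M) fp mdiff bdiff sdiff z).1.
have mq : measurable_fun setT (fun y : V => h^-1 * (psi (y + h *: v) - psi y)).
  exact: (measurable_funM (measurable_cst _) mdiff).
have bq (y : V) : `|h^-1 * (psi (y + h *: v) - psi y)| <= `|h^-1| * (M + M).
  by rewrite normrM ler_wpM2l.
have sq (y : V) : rho + 1 < `|y| -> h^-1 * (psi (y + h *: v) - psi y) = 0.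
  by move=> yr; rewrite sdiff// mulr0.
have i5 z := (HC f _ _ fp mq bq sq z).1.
have KE : convolution f K x = h^-1 * (convolution f psi (h *: v + x) - convolution f psi x)
   - convolution f D x.
  rewrite (@convolutionB _ _ f (fun y => h^-1 * (psi (y + h *: v) - psi y)) D)//.
  rewrite (@convolutionZ _ _ f (fun y => psi (y + h *: v) - psi y))//.
  rewrite (@convolutionB _ _ f (fun y => psi (y + h *: v)) psi)//.
  by rewrite [h *: v + x]addrC convolution_translate.
rewrite distrC /= -KE.
have mK : measurable_fun setT K by exact: (measurable_funB mq mD).
have bK (y : V) : `|K y| <= d.
  apply: difference_quotient_bound => // t /hr/Hr[+ _]; exact.
have sK (y : V) : rho + 1 < `|y| -> K y = 0.
  by move=> yr; rewrite /K sq// D1// subrr.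
have := (HC f K d fp mK bK sK x).2 => /le_trans; apply.
rewrite /d -mulrA mulrAC ler_pdivrMr ?ltr_wpDl//.
by rewrite ler_wpM2l ?(ltW e0)// lerDl.
Unshelve. all: by end_near. Qed.

Lemma Ck_continuous k f : Ck k f -> continuous f.
Proof. by case: k => [|k] []. Qed.

(** Each derivative falls on the kernel, so the induction is on [k] with [psi] arbitrary and [f]
    fixed. *)
Lemma convolution_Ck k f psi rho : LP f -> Ck k psi ->
  (forall y : V, rho < `|y| -> psi y = 0) -> Ck k (convolution f psi).
Proof.
move=> fp; elim: k psi => [|k ih] psi.
  by move=> [cpsi _] psi0; split=> //; exact: (convolution_continuous p1 fp cpsi psi0).
move=> [cpsi dpsi] psi0; split.
  exact: (convolution_continuous p1 fp cpsi psi0).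
move=> i; have [di Ci] := dpsi i.
have dc := convolution_derive fp cpsi di (Ck_continuous Ci) psi0.
split=> [x|]; first by have [] := dc x.
have -> : 'D_(unit_vector i) (convolution f psi) =
    convolution f ('D_(unit_vector i) psi).
  by apply/funext => x; have [_] := dc x.
by apply: ih => //; exact: derive_bounded_support.
Qed.

End Lp.

Lemma continuous_affine psi (c s : R) : continuous psi ->
  continuous (fun x : V => c * psi (s *: x)).
Proof.
move=> cpsi x.
have sc : {for x, continuous (fun x : V => s *: x)} by exact: scaler_continuous.
have cc : {for x, continuous (fun x : V => psi (s *: x))}.
  exact: (continuous_comp sc (cpsi _)).
exact: (continuous_comp cc (@mulrl_continuous R c _)).
Qed.

Lemma Ck_affine k psi (c s : R) : s != 0 -> Ck k psi ->
  Ck k (fun x : V => c * psi (s *: x)).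
Proof.
(* The factor [c] is generalized because each derivative multiplies it by [s]. *)
move=> s0; elim: k psi c => [|k ih] psi c.
  by move=> [cpsi _]; split=> //; exact: continuous_affine.
move=> [cpsi dpsi]; split; first exact: continuous_affine.
move=> i; have [di Ci] := dpsi i.
have dc x := derive_affine c s0 (di (s *: x)).
split=> [x|]; first by have [] := dc x.
have -> : 'D_(unit_vector i) (fun x => c * psi (s *: x)) =
    (fun x => c * s * 'D_(unit_vector i) psi (s *: x)).
  by apply/funext => x; have [_] := dc x.
exact: (ih _ (c * s) Ci).
Qed.

End convolution_derivatives.

(** * Density in L^p *)

Section Lnorm_convergence.
Context d {T : measurableType d} {R : realType}.
Variable mu : {measure set T -> \bar R}.
Variable p : R.
Hypothesis p1 : 1 <= p.
Implicit Types (f g h : T -> R) (D : set T).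
Local Notation "'N[ f ]" := (Lnorm mu p%:E (EFin \o f)).

Let p0 : 0 < p. Proof. exact: lt_le_trans p1. Qed.

(** At a nonzero limit the power function is differentiable; at 0 the bound [t ^ p <= t] for
    [0 < t <= 1], a consequence of [1 <= p], is used instead. *)
Lemma cvg_abs_powR (u : nat -> R) (l : R) : u k @[k --> \oo] --> l ->
  `|u k| `^ p @[k --> \oo] --> `|l| `^ p.
Proof.
move=> ul; have [l0|l0] := eqVneq l 0; last first.
  have cp : {for `|l|, continuous (@powR R ^~ p)}.
    have l0' : 0 < `|l| by rewrite normr_gt0.
    apply: differentiable_continuous; apply/derivable1_diffP.
    by have [] := is_derive1_powR p l0'.
  by apply: (continuous_cvg _ cp); exact: cvg_norm.
rewrite l0 normr0 powR0 ?gt_eqF//.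
apply/cvgrPdist_le => r r0.
have r10 : 0 < Num.min r 1 by rewrite lt_min r0 ltr01.
move: ul; rewrite l0 => /cvgrPdist_le/(_ _ r10); apply: filterS => k /=.
rewrite !sub0r !normrN [X in X <= r]ger0_norm ?powR_ge0//.
rewrite le_min => /andP[ur u1].
have [->|uk0] := eqVneq (u k) 0; first by rewrite normr0 powR0 ?gt_eqF// ltW.
by rewrite (le_trans _ ur)// ge1r_powR// u1 andbT normr_gt0.
Qed.

Local Open Scope ereal_scope.

Lemma Lnorm_lt f (e : R) : (0 < e)%R ->
  \int[mu]_x (`|f x| `^ p)%:E < (e `^ p)%:E -> 'N[f] < e%:E.
Proof.
move=> e0; rewrite (integral_Lnorm mu p1) => H; rewrite ltNge; apply/negP => eN.
move: H; rewrite ltNge -poweR_EFin => /negP; apply.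
apply: (gt0_ler_poweR (ltW p0)) => //; rewrite in_itv/= leey andbT ?lee_fin ?(ltW e0)//.
exact: Lnorm_ge0.
Qed.

Lemma Lnorm_dominated_cvg (u : nat -> T -> R) h :
  (forall k, measurable_fun setT (u k)) -> measurable_fun setT h ->
  'N[h] < +oo -> (forall k x, `|u k x| <= h x)%R ->
  {ae mu, forall x, (u k x @[k --> \oo] --> (0 : R))%R} ->
  forall e : R, (0 < e)%R -> \forall k \near \oo, 'N[u k] < e%:E.
Proof.
move=> mu_ mh hoo uh u0 e e0.
have H := @dominated_convergence _ _ _ mu setT measurableT
  (fun k x => (`|u k x| `^ p)%:E) (cst 0) (fun x => (`|h x| `^ p)%:E).
have {H} : (\int[mu]_x (`|u k x| `^ p)%:E) @[k --> \oo] --> 0.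
  case: H => [| | | | |_ _]; last by rewrite integral0.
  - by move=> k; exact: measurable_abs_powR.
  - exact: measurable_cst.
  - case: u0 => N [mN N0 HN]; exists N; split=> // x /= Hx; apply: HN => /= ux.
    apply: Hx => _; apply: cvg_EFin; first exact: nearW.
    by have := cvg_abs_powR ux; rewrite normr0 powR0 ?gt_eqF.
  - apply/integrableP; split; first exact: measurable_abs_powR.
    under eq_integral do rewrite gee0_abs ?lee_fin ?powR_ge0//.
    by rewrite (integral_Lnorm mu p1) poweR_lty.
  - apply/nearW => x k _; rewrite gee0_abs ?lee_fin ?powR_ge0//.
    apply: ge0_ler_powR; rewrite ?nnegrE ?(ltW p0)//.
    exact: le_trans (uh k x) (ler_norm _).
move=> /fine_cvgP[fin /cvgrPdist_lt H].
have ep : (0 < e `^ p)%R by rewrite powR_gt0.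
have {}H := H _ ep.
near=> k; apply: Lnorm_lt => //.
have fk : \int[mu]_x (`|u k x| `^ p)%:E \is a fin_num by near: k.
rewrite -(fineK fk) lte_fin; apply: le_lt_trans (ler_norm _) _.
by rewrite -normrN -sub0r; near: k.
Unshelve. all: by end_near. Qed.

Lemma Lnorm_triangle f g h : measurable_fun setT f -> measurable_fun setT g ->
  measurable_fun setT h -> 'N[(f \- h)%R] <= 'N[(f \- g)%R] + 'N[(g \- h)%R].
Proof.
move=> mf mg mh; rewrite (_ : (f \- h = (f \- g) \+ (g \- h))%R).
  by apply: minkowski_EFin => //; exact: measurable_funB.
by apply/funext => x /=; rewrite addrA subrK.
Qed.

Lemma Lnorm_indic A : measurable A -> 'N[\1_A] = mu A `^ p^-1.
Proof.
move=> mA; rewrite Lnorm_integral; congr (_ `^ _).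
rewrite -[in RHS](setIT A) -integral_indic//.
apply: eq_integral => x _; rewrite indicE.
by case: (_ \in _); rewrite /= ?normr1 ?powR1// normr0 powR0// gt_eqF.
Qed.

Lemma Lnorm_scale f (a : R) : measurable_fun setT f ->
  'N[(fun x => a * f x)%R] = `|a|%:E * 'N[f].
Proof.
move=> mf; rewrite !Lnorm_integral.
under eq_integral do rewrite normrM powRM// EFinM.
rewrite ge0_integralZl//=; last exact: measurable_abs_powR.
rewrite poweRM ?lee_fin ?powR_ge0//; last first.
  by apply: integral_ge0 => x _; rewrite lee_fin powR_ge0.
by rewrite poweR_EFin -powRrM mulfV ?gt_eqF// powRr1.
Qed.

End Lnorm_convergence.

(** * A dense class of almost everywhere continuous functions *)

Section nice_functions.
Context {R : realType} {n : nat}.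
Local Notation V := 'rV[R]_n.+1.
Local Notation mu := (@lebesgue R n).
Implicit Types (f g : V -> R) (A B : set V).

(* Lebesgue measurability of [g] does not imply that [(x, y) |-> g (x - y)] is
   measurable for the product of the Lebesgue sigma-algebras, and Tonelli's
   theorem needs it.  Indicators of finite unions of boxes satisfy all five
   conditions and their span is dense. *)
Definition nice g := [/\ measurable_fun setT g,
  measurable_fun setT (fun z : V * V => g (z.1 - z.2)),
  exists M, forall x, `|g x| <= M,
  exists rho, forall x : V, rho < `|x| -> g x = 0 &
  {ae mu, forall x, {for x, continuous g}}].

Lemma nice0 : nice (cst 0).
Proof.
split; [exact: measurable_cst|exact: measurable_cst| | |].
- by exists 0 => x; rewrite normr0.
- by exists 0.
- by apply: nearW => x; exact: cst_continuous.
Qed.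

Lemma niceD f g : nice f -> nice g -> nice (f \+ g).
Proof.
move=> [mf pf [M fM] [r fr] cf] [mg pg [N gN] [s gs] cg]; split.
- exact: measurable_funD.
- exact: (measurable_funD pf pg).
- by exists (M + N) => x; rewrite (le_trans (ler_normD _ _))// lerD.
- exists (Num.max r s) => x; rewrite gt_max => /andP[rx sx] /=.
  by rewrite fr// gs// addr0.
- near=> x.
  have cfx : {for x, continuous f} by near: x.
  have cgx : {for x, continuous g} by near: x.
  exact: (@continuousD _ _ _ f g x cfx cgx).
Unshelve. all: by end_near. Qed.

Lemma niceM f g : nice f -> nice g -> nice (f \* g).
Proof.
move=> [mf pf [M fM] [r fr] cf] [mg pg [N gN] [s gs] cg]; split.
- exact: measurable_funM.
- exact: (measurable_funM pf pg).
- by exists (M * N) => x; rewrite normrM ler_pM.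
- by exists r => x rx /=; rewrite fr// mul0r.
- near=> x.
  have cfx : {for x, continuous f} by near: x.
  have cgx : {for x, continuous g} by near: x.
  exact: (@continuousM _ _ f g x cfx cgx).
Unshelve. all: by end_near. Qed.

Lemma niceZ f (a : R) : nice f -> nice (fun x => a * f x).
Proof.
move=> [mf pf [M fM] [r fr] cf]; split.
- exact: (measurable_funM (measurable_cst a) mf).
- exact: (measurable_funM (measurable_cst a) pf).
- by exists (`|a| * M) => x; rewrite normrM ler_wpM2l.
- by exists r => x rx /=; rewrite fr// mulr0.
- near=> x.
  have cfx : {for x, continuous f} by near: x.
  exact: (continuous_comp cfx (@mulrl_continuous R a _)).
Unshelve. all: by end_near. Qed.

Lemma measurable_coordB i :
  measurable_fun setT (fun z : V * V => (z.1 - z.2) ord0 i).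
Proof.
rewrite (_ : (fun z => _) =
    (fun z : V * V => z.1 ord0 i) \- (fun z : V * V => z.2 ord0 i)).
  apply: measurable_funB.
    exact: (measurableT_comp (measurable_coord i) measurable_fst).
  exact: (measurableT_comp (measurable_coord i) measurable_snd).
by apply/funext => z; rewrite /= !mxE.
Qed.

(** The face lies in a box whose [i]-th side is reduced to a point, hence of volume 0. *)
Lemma box_face_null (ab : V * V) i c : (forall j, ab.1 ord0 j <= ab.2 ord0 j) ->
  mu.-negligible [set x | closed_box ab x /\ x ord0 i = c].
Proof.
move=> ab0; pose Q : V * V := (set_coord ab.1 i c, set_coord ab.2 i c).
exists (closed_box Q); split; first exact: closed_box_measurable.
  apply/eqP; rewrite eq_le measure_ge0 andbT.
  apply: (le_trans (lebesgue_closed_box_le _)) => [j|].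
    by rewrite !mxE; case: ifP.
  rewrite lee_fin /box_volume (bigD1 i)//= !mxE eqxx subrr mul0r//.
move=> x /= [abx xc] j; rewrite !mxE; case: eqP => [->|_]; last exact: abx.
by rewrite xc lexx.
Qed.

(** The hypothesis excludes the boundary of the box; off it, membership is locally constant. *)
Lemma continuous_indic_box (ab : V * V) (x : V) :
  (closed_box ab x -> forall i, ab.1 ord0 i < x ord0 i < ab.2 ord0 i) ->
  {for x, continuous (\1_(closed_box ab) : V -> R)}.
Proof.
move=> abx'.
suff H : \forall y \near nbhs x, (y \in closed_box ab) = (x \in closed_box ab).
  have H' : \forall y \near nbhs x,
      (\1_(closed_box ab) : V -> R) y = (\1_(closed_box ab) : V -> R) x.
    by apply: filterS H => y H; rewrite !indicE H.
  by move=> A /nbhs_singleton Ax; apply: filterS H' => y Hy; rewrite /= Hy.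
have lt_near i c : x ord0 i < c -> \forall y \near nbhs x, (y : V) ord0 i < c.
  move=> xc; apply/nbhs_ballP; exists (c - x ord0 i) => /=; first by rewrite subr_gt0.
  move=> y [_ /(_ ord0 i)]; rewrite -ball_normE /ball_ /= ltr_norml => /andP[] *.
  by lra.
have gt_near i c : c < x ord0 i -> \forall y \near nbhs x, c < (y : V) ord0 i.
  move=> xc; apply/nbhs_ballP; exists (x ord0 i - c) => /=; first by rewrite subr_gt0.
  move=> y [_ /(_ ord0 i)]; rewrite -ball_normE /ball_ /= ltr_norml => /andP[] *.
  by lra.
have [abx|abx] := pselect (closed_box ab x).
  rewrite (mem_set abx).
  have : \forall y \near nbhs x, forall i, ab.1 ord0 i <= (y : V) ord0 i <= ab.2 ord0 i.
    apply: filter_forall => i; have /andP[ax' xb'] := abx' abx i.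
    by apply: filterS2 (gt_near _ _ ax') (lt_near _ _ xb') => y /ltW -> /ltW ->.
  by apply: filterS => y yab; rewrite mem_set.
rewrite (memNset abx).
move/existsNP : abx => [i /negP]; rewrite negb_and -!ltNge => /orP[xi|xi].
  apply: filterS (lt_near _ _ xi) => y yi; rewrite memNset// => /(_ i).
  by rewrite leNgt yi.
apply: filterS (gt_near _ _ xi) => y yi; rewrite memNset// => /(_ i).
by rewrite [X in _ && X]leNgt yi andbF.
Qed.

Lemma nice_box (ab : V * V) : (forall j, ab.1 ord0 j <= ab.2 ord0 j) ->
  nice (\1_(closed_box ab)).
Proof.
move=> ab0; split.
- by apply: measurable_indic; exact: closed_box_measurable.
- rewrite (_ : (fun z => _) =
      \1_([set z : V * V | closed_box ab (z.1 - z.2)])); last first.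
    by apply/funext => z; rewrite !indicE.
  apply: measurable_indic; rewrite [X in measurable X](_ : _ =
      \bigcap_(i in [set: 'I_n.+1])
      ((fun z : V * V => (z.1 - z.2) ord0 i) @^-1` `[ab.1 ord0 i, ab.2 ord0 i])).
    apply: fin_bigcap_measurable => // i _.
    by rewrite -[X in measurable X]setTI; exact: measurable_coordB.
  apply/seteqP; split=> z.
    by move=> zab i _; rewrite /= in_itv/=; exact: zab.
  by move=> zab i; have := zab i I; rewrite /= in_itv.
- exists 1 => x; rewrite indicE ger0_norm//.
  by case: (_ \in _) => //=; rewrite ler01.
- exists (`|ab.1| + `|ab.2|) => x xab; rewrite indicE memNset// => abx.
  move: xab; apply/negP; rewrite -leNgt; apply: rV_norm_le.
    by rewrite addr_ge0.
  move=> i; have /andP[ax xb] := abx i.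
  have := coord_norm_le ab.1 i; have := coord_norm_le ab.2 i.
  rewrite !ler_norml => /andP[b1 b2] /andP[a1 a2].
  have A0 := normr_ge0 ab.1; have B0 := normr_ge0 ab.2.
  by apply/andP; split; lra.
(* Discontinuities lie on the faces. They are indexed by [nat] so that countable subadditivity
   applies; [F k] is empty once [k > n]. *)
- pose F (k : nat) := [set x : V | closed_box ab x /\
     exists2 i : 'I_n.+1, i = k :> nat & x ord0 i = ab.1 ord0 i \/ x ord0 i = ab.2 ord0 i].
  have nF : mu.-negligible (\bigcup_k F k).
    apply: negligible_bigcup => k.
    have [kn|kn] := ltnP k n.+1; last first.
      apply: (negligibleS _ (negligible_set0 mu)) => x [_ [i ik _]].
      by move: kn; rewrite -ik leqNgt ltn_ord.
    have := negligibleU (box_face_null (Ordinal kn) (ab.1 ord0 (Ordinal kn)) ab0)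
      (box_face_null (Ordinal kn) (ab.2 ord0 (Ordinal kn)) ab0).
    apply: negligibleS => x [abx [i ik]].
    have -> : i = Ordinal kn by exact: val_inj.
    by move=> [E|E]; [left|right].
  apply: negligibleS nF => x /= nc.
  apply: contrapT => nx; apply: nc.
  apply: continuous_indic_box => abx i; have /andP[ax xb] := abx i.
  rewrite !lt_neqAle ax xb !andbT; apply/andP; split; apply/eqP => E; apply: nx.
    by exists i => //; split=> //; exists i => //; left.
  by exists i => //; split=> //; exists i => //; right.
Qed.

Lemma nice_bigsetU_box (Q : nat -> V * V) N :
  (forall k j, (Q k).1 ord0 j <= (Q k).2 ord0 j) ->
  nice (\1_(\big[setU/set0]_(k < N) closed_box (Q k))).
Proof.
move=> Q0; elim: N => [|N ih]; first by rewrite big_ord0 indic0; exact: nice0.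
rewrite big_ord_recr/=; set A := \big[setU/set0]_(k < N) _ in ih *.
set B := closed_box _.
have nB : nice (\1_B) by exact: nice_box.
(* Inclusion-exclusion: the indicator of the union is the sum of the two indicators minus their
   product. *)
have := niceD (niceD ih nB) (niceZ (-1) (niceM ih nB)).
congr nice; apply/funext => x /=; rewrite !indicE in_setU.
by do 2!case: (_ \in _) => /=; ring.
Qed.

Section density.
Variable p : R.
Hypothesis p1 : 1 <= p.
Local Notation NP f := (Lp_norm p%:E f%R).

Let p0 : 0 < p. Proof. exact: lt_le_trans p1. Qed.

Definition approximable f := measurable_fun setT f /\
  forall e : R, 0 < e -> exists2 g, nice g & (NP (f \- g) < e%:E)%E.

Lemma nice_approximable g : nice g -> approximable g.
Proof.
move=> ng; have [mg _ _ _ _] := ng; split=> // e e0; exists g => //.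
rewrite (_ : g \- g = cst 0); last by apply/funext => x /=; rewrite subrr.
by rewrite /Lp_norm Lnorm0 ?lte_fin// eqe gt_eqF.
Qed.

Lemma approximable_lim f : measurable_fun setT f ->
  (forall e : R, 0 < e -> exists2 h, approximable h & (NP (f \- h) < e%:E)%E) ->
  approximable f.
Proof.
move=> mf fh; split=> // e e0.
have e2 : 0 < e / 2 by rewrite divr_gt0.
have [h [mh hg] fhe] := fh _ e2.
have [g ng hge] := hg _ e2; have [mg _ _ _ _] := ng; exists g => //.
apply: (le_lt_trans (Lnorm_triangle mu p1 mf mh mg)).
by rewrite [in X in (_ < X)%E](splitr e) EFinD lteD.
Qed.

Lemma approximableD f g : approximable f -> approximable g -> approximable (f \+ g).
Proof.
move=> [mf fa] [mg ga]; split; first exact: measurable_funD.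
move=> e e0; have e2 : 0 < e / 2 by rewrite divr_gt0.
have [f' nf' ff'] := fa _ e2; have [g' ng' gg'] := ga _ e2.
have [mf' _ _ _ _] := nf'; have [mg' _ _ _ _] := ng'.
exists (f' \+ g'); first exact: niceD.
rewrite (_ : _ \- _ = (f \- f') \+ (g \- g')); last first.
  by apply/funext => x /=; rewrite opprD addrACA.
apply: (@le_lt_trans _ _ (NP (f \- f') + NP (g \- g'))%E).
  exact: (minkowski_EFin mu (measurable_funB mf mf') (measurable_funB mg mg') p1).
by rewrite [in X in (_ < X)%E](splitr e) EFinD lteD.
Qed.

Lemma approximableZ f (a : R) : approximable f -> approximable (fun x => a * f x).
Proof.
move=> [mf fa]; split; first exact: (measurable_funM (measurable_cst a) mf).
move=> e e0; have a0 : 0 < `|a| + 1 by rewrite ltr_wpDl.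
have [g ng fg] := fa _ (divr_gt0 e0 a0); have [mg _ _ _ _] := ng.
exists (fun x => a * g x); first exact: niceZ.
rewrite (_ : _ \- _ = (fun x => a * (f \- g) x)); last first.
  by apply/funext => x /=; rewrite mulrBr.
rewrite /Lp_norm (Lnorm_scale mu p1); last exact: measurable_funB.
apply: (@le_lt_trans _ _ ((`|a| + 1)%:E * NP (f \- g))%E).
  by rewrite lee_wpmul2r ?lee_fin ?lerDl// Lnorm_ge0.
by rewrite muleC -lte_pdivlMr.
Qed.

Lemma approximable_sum m (F : 'I_m -> V -> R) : (forall i, approximable (F i)) ->
  approximable (fun x => \sum_(i < m) F i x).
Proof.
elim: m F => [F _|m ih F aF].
  rewrite (_ : (fun x => _) = cst 0); first exact/nice_approximable/nice0.
  by apply/funext => x; rewrite big_ord0.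
rewrite (_ : (fun x => _) =
    (fun x => \sum_(i < m) F (widen_ord (leqnSn m) i) x) \+ F ord_max); last first.
  by apply/funext => x; rewrite big_ord_recr.
exact: (approximableD (ih _ (fun i => aF _)) (aF _)).
Qed.

(** The definition of the outer measure gives a box cover of [A] with little excess volume;
    continuity from below truncates it to a finite union. *)
Lemma approximable_indic A : measurable A -> (mu A < +oo)%E -> approximable (\1_A).
Proof.
move=> mA Aoo; split; first exact: measurable_indic.
move=> e e0; pose dl := e `^ p / 3.
have ep : 0 < e `^ p by rewrite powR_gt0.
have d0 : 0 < dl by rewrite divr_gt0.
have Afin : mu A \is a fin_num by rewrite ge0_fin_numE// measure_ge0.
have [_ [Q [Q0 AQ] <-] volA] := lb_ereal_inf_adherent d0 Afin.
pose U := \bigcup_k closed_box (Q k).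
have mQ k : measurable (closed_box (Q k)) by exact: closed_box_measurable.
have mU : measurable U by exact: bigcupT_measurable.
have muU : (mu U < mu A + dl%:E)%E.
  apply: le_lt_trans volA.
  apply: (@le_trans _ _ (\sum_(0 <= k <oo) mu (closed_box (Q k)))%E).
    by apply: (measure_sigma_subadditive mu).
  by apply: lee_nneseries => k _; [move=> _; exact: measure_ge0|exact: lebesgue_closed_box_le].
have Uoo : (mu U < +oo)%E.
  rewrite (lt_trans muU)// -ge0_fin_numE ?fin_numD ?Afin//.
  by rewrite adde_ge0 ?measure_ge0// lee_fin ltW.
have Ufin : mu U \is a fin_num by rewrite ge0_fin_numE// measure_ge0.
pose UN N := \big[setU/set0]_(k < N) closed_box (Q k).
have mUN N : measurable (UN N) by exact: bigsetU_measurable.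
have UNU N : UN N `<=` U.
  by rewrite /UN -(bigcup_mkord N (fun k => closed_box (Q k))) => x [k _ Qx]; exists k.
have cvgU : (mu (UN N) @[N --> \oo] --> mu U)%E.
  rewrite (_ : U = \bigcup_N UN N); last first.
    apply/seteqP; split=> [x [k _ Qx]|x [N _ /UNU]//].
    by exists k.+1 => //; rewrite /UN big_ord_recr; right.
  apply: nondecreasing_cvg_mu => //; first exact: bigcupT_measurable.
  move=> a b ab; rewrite subsetEset /UN -!(bigcup_mkord _ (fun k => closed_box (Q k))).
  by move=> x [k ka Qx]; exists k => //; exact: leq_trans ab.
have [N UNd] : exists N, (mu (U `\` UN N) < dl%:E)%E.
  move: cvgU; rewrite -(fineK Ufin) => /fine_cvgP[_ /cvgrPdist_lt/(_ _ d0)[N _ HN]].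
  exists N; have := HN N (leqnn N).
  rewrite measureD// setIidr// => /(le_lt_trans (ler_norm _)).
  have UNfin : mu (UN N) \is a fin_num.
    by rewrite ge0_fin_numE ?measure_ge0// (le_lt_trans _ Uoo)// le_measure// inE.
  change (fine (mu U) - fine (mu (UN N)) < dl -> (mu U - mu (UN N) < dl%:E)%E).
  by rewrite -lte_fin EFinB !fineK.
exists (\1_(UN N)); first exact: nice_bigsetU_box.
have mUA : measurable (U `\` A) by exact: measurableD.
have mUUN : measurable (U `\` UN N) by exact: measurableD.
have mind (B : set V) : measurable B -> measurable_fun setT (fun x => (\1_B x : R)%:E).
  by move=> mB; exact/measurable_EFinP/measurable_indic.
apply: (Lnorm_lt p1 e0).
(* [A] and [UN N] both lie in [U], so they differ only on the two complements in [U]. Each has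
   measure below [dl], a third of [e ^ p]. *)
apply: (@le_lt_trans _ _ (\int[mu]_x ((\1_(U `\` A) x)%:E + (\1_(U `\` UN N) x)%:E))%E).
  apply: (ge0_le_integral mu measurableT).
  - by move=> x _; rewrite lee_fin powR_ge0.
  - exact: (measurable_abs_powR p
      (measurable_funB (measurable_indic mA) (measurable_indic (mUN N)))).
  - exact: (emeasurable_funD (mind _ mUA) (mind _ mUUN)).
  - move=> x _ /=; rewrite -EFinD lee_fin !indicE !in_setD.
    have := @in_setU; have AU : x \in A -> x \in U by rewrite !inE => /AQ.
    have VU : x \in UN N -> x \in U by rewrite !inE => /UNU.
    move: AU VU; case: (x \in A); case: (x \in UN N) => /= AU VU _.
    - by rewrite subrr normr0 powR0 ?gt_eqF// addr_ge0.
    - by rewrite AU// subr0 normr1 powR1 andbF add0r.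
    - by rewrite VU// sub0r normrN1 powR1 andbF addr0.
    - by rewrite subrr normr0 powR0 ?gt_eqF// addr_ge0.
rewrite (ge0_integralD mu measurableT _ (mind _ mUA) _ (mind _ mUUN));
  [|by move=> x _; rewrite lee_fin..].
rewrite !integral_indic// !setIT.
have UAd : (mu (U `\` A) < dl%:E)%E.
  by rewrite measureD// setIidr// lteBlDl.
apply: (lt_le_trans (lteD UAd UNd)).
rewrite -EFinD lee_fin /dl; lra.
Qed.

Import HBNNSimple.

Lemma approximable_nnsfun (s : {nnsfun V >-> R}) :
  (NP s < +oo)%E -> approximable s.
Proof.
move=> soo.
have ms : measurable_fun setT s by exact: measurable_funPT.
have sE := funext (fimfunEord s); rewrite sE.
apply: approximable_sum => i; set c := _`_i.
(* The level set of the value 0 may have infinite measure. For [c != 0] the L^p norm of [s] controls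
   that of [c * \1_A] and forces [A] to have finite measure. *)
have [->|c0] := eqVneq c 0.
  rewrite (_ : (fun x => _) = cst 0); first exact/nice_approximable/nice0.
  by apply/funext => x; rewrite mul0r.
set A := s @^-1` _.
have mA : measurable A by exact: measurable_sfunP.
apply/approximableZ/approximable_indic => //.
have : (NP (fun x => c * \1_A x) <= NP s)%E.
  apply: (le_Lnorm mu p1 (measurable_funM (measurable_cst c) (measurable_indic mA)) ms).
  move=> x; rewrite /= indicE; case: (boolP (x \in A)) => [|_]; last first.
    by rewrite mulr0 normr0.
  by rewrite inE /A /= mulr1 => ->.
move=> /le_lt_trans/(_ soo).
rewrite /Lp_norm (Lnorm_scale mu p1); last exact: measurable_indic.
rewrite (Lnorm_indic mu p1 mA) => H.
have {}H : (`|c|%:E * mu A `^ p^-1 < +oo)%E := H.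
rewrite ltNge leye_eq; apply/eqP => muA; move: H.
by rewrite muA poweRyr ?gt_eqF ?invr_gt0// gt0_muley ?ltxx// lte_fin normr_gt0.
Qed.

(** Simple functions increase to [f] pointwise, and the differences are dominated by [f] itself. *)
Lemma approximable_ge0 f : measurable_fun setT f -> (forall x, 0 <= f x) ->
  (NP f < +oo)%E -> approximable f.
Proof.
move=> mf f0 foo; apply: approximable_lim => // e e0.
have mfE : measurable_fun setT (EFin \o f) by exact/measurable_EFinP.
pose s := nnsfun_approx measurableT mfE.
have f0E x : setT x -> (0 <= (EFin \o f) x)%E by move=> _; rewrite lee_fin.
have scvg x : s k x @[k --> \oo] --> f x.
  by have /fine_cvgP[] := cvg_nnsfun_approx measurableT mfE f0E (x := x) I.
have sf k x : s k x <= f x.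
  have nd : nondecreasing_seq (s ^~ x).
    by move=> a b ab; have /lefP := nd_nnsfun_approx measurableT mfE ab.
  rewrite -(cvg_lim (@Rhausdorff R) (scvg x)).
  by apply: nondecreasing_cvgn_le => //; apply/cvg_ex; exists (f x).
have ms k : measurable_fun setT (s k) by exact: measurable_funPT.
have uf k x : `|(f \- s k) x| <= f x.
  by rewrite /= ger0_norm ?subr_ge0// lerBlDr lerDl.
have ucvg x : (f \- s k) x @[k --> \oo] --> (0 : R).
  by rewrite -(subrr (f x)); apply: cvgB; [exact: cvg_cst|exact: scvg].
have uae : {ae mu, forall x, (f \- s k) x @[k --> \oo] --> (0 : R)}.
  by apply: nearW => x; exact: ucvg.
have [k _ Hk] := Lnorm_dominated_cvg p1 (fun k => measurable_funB mf (ms k)) mf foo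
  uf uae e0.
exists (s k); last exact: (Hk k (leqnn k)).
apply: approximable_nnsfun; apply: le_lt_trans foo.
apply: (le_Lnorm mu p1 (ms k) mf) => x.
by rewrite !ger0_norm.
Qed.

Lemma Lp_approximable f : Lp p%:E f -> approximable f.
Proof.
move=> /LpP[mf foo].
have -> : f = f^\+ \+ (fun x => -1 * f^\- x).
  by rewrite -{1}(funrposBneg f); apply/funext => x /=; rewrite mulN1r.
apply: approximableD; [|apply: approximableZ]; apply: approximable_ge0.
- exact: measurable_funrpos.
- by move=> x; exact: funrpos_ge0.
- apply: le_lt_trans foo; apply: (le_Lnorm mu p1 (measurable_funrpos mf) mf) => x.
  rewrite ger0_norm ?funrpos_ge0//; have /(congr1 (@^~ x)) /= <- := funrposDneg f.
  by rewrite lerDl ?funrneg_ge0 ?funrpos_ge0.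
- exact: measurable_funrneg.
- by move=> x; exact: funrneg_ge0.
- apply: le_lt_trans foo; apply: (le_Lnorm mu p1 (measurable_funrneg mf) mf) => x.
  rewrite ger0_norm ?funrneg_ge0//; have /(congr1 (@^~ x)) /= <- := funrposDneg f.
  by rewrite lerDr ?funrneg_ge0 ?funrpos_ge0.
Qed.

End density.

End nice_functions.

(** * Minkowski's integral inequality *)

Section Lnorm_fatou.
Context d {T : measurableType d} {R : realType}.
Variable mu : {measure set T -> \bar R}.
Variable p : R.
Hypothesis p1 : 1 <= p.
Implicit Types (f g h : T -> R) (D : set T).
Local Notation "'N[ f ]" := (Lnorm mu p%:E (EFin \o f)).

Let p0 : 0 < p. Proof. exact: lt_le_trans p1. Qed.

Local Open Scope ereal_scope.

Lemma limn_einf_le (a : (\bar R)^nat) (B : \bar R) : (forall k, a k <= B) ->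
  limn_einf a <= B.
Proof.
move=> aB; rewrite limn_einf_lim; apply: lime_le; first exact: is_cvg_einfs.
apply: nearW => k; apply: le_trans (aB k).
by apply: ereal_inf_lbound; exists k => /=.
Qed.

Lemma Lnorm_le f (c : R) : (0 <= c)%R ->
  \int[mu]_x (`|f x| `^ p)%:E <= (c `^ p)%:E -> 'N[f] <= c%:E.
Proof.
move=> c0 H; rewrite Lnorm_integral; apply: (@le_trans _ _ ((c `^ p)%:E `^ p^-1)).
  have p0' : (0 <= p^-1)%R by rewrite invr_ge0 ltW.
  apply: (gt0_ler_poweR p0') => //; rewrite in_itv/= leey andbT ?lee_fin ?powR_ge0//.
  by apply: integral_ge0 => x _; rewrite lee_fin powR_ge0.
by rewrite poweR_EFin -powRrM mulfV ?gt_eqF// powRr1.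
Qed.

Lemma Lnorm_fatou (u : nat -> T -> R) f (c : R) : (0 <= c)%R ->
  (forall k, measurable_fun setT (u k)) -> measurable_fun setT f ->
  (forall x, u k x @[k --> \oo] --> f x)%R ->
  (forall k, 'N[u k] <= c%:E) -> 'N[f] <= c%:E.
Proof.
move=> c0 mu_ mf uf uc.
apply: Lnorm_le => //.
have -> : (fun x => (`|f x| `^ p)%:E) =
    (fun x => limn_einf (fun k => (`|u k x| `^ p)%:E)).
  apply/funext => x; apply/esym.
  have : (`|u k x| `^ p)%:E @[k --> \oo] --> (`|f x| `^ p)%:E.
    by apply: cvg_EFin; [exact: nearW|exact: (cvg_abs_powR p1 (uf x))].
  by move=> /cvg_limn_einf_sup[].
have uk0 k x : setT x -> 0 <= (`|u k x| `^ p)%:E by rewrite lee_fin powR_ge0.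
apply: (le_trans (fatou mu measurableT (fun k => measurable_abs_powR p (mu_ k)) uk0)).
apply: limn_einf_le => k; rewrite (integral_Lnorm mu p1) -poweR_EFin.
apply: (gt0_ler_poweR (ltW p0)) => //; rewrite in_itv/= leey andbT ?lee_fin//.
exact: Lnorm_ge0.
Qed.

(* Hoelder's inequality for [|f| |k|^(1/p)] and [|k|^(1/q)]. *)
Lemma weighted_hoelder f (k : T -> R) : measurable_fun setT f -> measurable_fun setT k ->
  (\int[mu]_x `|f x * k x|%:E) `^ p <=
  (\int[mu]_x `|k x|%:E) `^ (p - 1) * \int[mu]_x (`|f x| `^ p * `|k x|)%:E.
Proof.
move=> mf mk.
have mak : measurable_fun setT (fun x => `|k x|%R).
  exact: (measurableT_comp (@normr_measurable R setT) mk).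
have mabf : measurable_fun setT (fun x => `|f x|%R).
  exact: (measurableT_comp (@normr_measurable R setT) mf).
have mpow (r : R) : measurable_fun setT (fun x => `|k x| `^ r)%R.
  exact: (measurableT_comp (@measurable_powR R r) mak).
(* For [p = 1] the conjugate exponent is infinite; the first factor is then a zeroth power, equal to
   1 for every value of the integral. *)
move: p1; rewrite le_eqVlt => /predU1P[p1'|p1'].
  rewrite -p1' subrr poweRe0 mul1e poweRe1; last first.
    by apply: integral_ge0 => x _; rewrite lee_fin.
  rewrite le_eqVlt; apply/predU1P; left; apply: eq_integral => x _.
  by rewrite powRr1// normrM.
pose q := (p / (p - 1))%R.
have p10 : (0 < p - 1)%R by rewrite subr_gt0.
have q0 : (0 < q)%R by rewrite divr_gt0.
have pq : (p^-1 + q^-1 = 1)%R.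
  by rewrite /q invf_div -{1}(div1r p) -mulrDl subrKC mulfV// gt_eqF.
pose a x := (`|f x| * `|k x| `^ p^-1)%R; pose b x := (`|k x| `^ q^-1)%R.
have ma : measurable_fun setT a by exact: (measurable_funM mabf (mpow _)).
have mb : measurable_fun setT b by exact: mpow.
have := hoelder mu ma mb p0 q0 pq; rewrite Lnorm1.
have -> : \int[mu]_x `|(EFin \o (a \* b)%R) x| = \int[mu]_x `|f x * k x|%:E.
  apply: eq_integral => x _ /=; rewrite /a /b -mulrA -powRD; last first.
    by rewrite pq oner_eq0.
  by rewrite pq powRr1// -normrM normr_id.
move=> H.
apply: (@le_trans _ _ ((Lnorm mu p%:E (EFin \o a) * Lnorm mu q%:E (EFin \o b)) `^ p)).
  apply: (gt0_ler_poweR (ltW p0)) => //; rewrite in_itv/= leey andbT.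
    by apply: integral_ge0 => x _; rewrite lee_fin.
  by rewrite mule_ge0 ?Lnorm_ge0.
rewrite poweRM ?Lnorm_ge0// muleC.
have -> : Lnorm mu q%:E (EFin \o b) `^ p = (\int[mu]_x `|k x|%:E) `^ (p - 1).
  rewrite Lnorm_integral -poweRrM; congr (_ `^ _).
    apply: eq_integral => x _; rewrite /b ger0_norm ?powR_ge0// -powRrM mulVf ?gt_eqF// powRr1//.
  by rewrite /q invf_div divfK// gt_eqF.
rewrite le_eqVlt; apply/predU1P; left; congr (_ * _).
rewrite -(integral_Lnorm mu p1); apply: eq_integral => x _.
rewrite /a normrM normr_id [X in (_ * X)%R]ger0_norm ?powR_ge0// powRM ?powR_ge0//.
by rewrite -powRrM mulVf ?gt_eqF// powRr1.
Qed.

End Lnorm_fatou.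

Section minkowski_integral.
Context d1 d2 {T1 : measurableType d1} {T2 : measurableType d2} {R : realType}.
Variables (m1 : {sigma_finite_measure set T1 -> \bar R})
  (m2 : {sigma_finite_measure set T2 -> \bar R}).
Variable p : R.
Hypothesis p1 : 1 <= p.

Let p0 : 0 < p. Proof. exact: lt_le_trans p1. Qed.

Local Open Scope ereal_scope.

Lemma measurable_integral_powR (h : T1 -> T2 -> R) (K : T2 -> R) :
  measurable_fun setT (fun z : T1 * T2 => h z.1 z.2) -> measurable_fun setT K ->
  measurable_fun setT (fun x => (\int[m2]_y `|h x y * K y|%:E) `^ p).
Proof.
move=> mh mK.
apply: (@measurableT_comp _ _ _ _ _ _ (@poweR R ^~ p)); first exact: measurable_poweR.
apply: (measurable_fun_fubini_tonelli_F (fun z => `|h z.1 z.2 * K z.2|%:E)).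
  apply/measurable_EFinP/measurableT_comp => //; apply: measurable_funM => //.
  exact: (measurableT_comp mK measurable_snd).
by move=> z; rewrite lee_fin.
Qed.

(** The weighted Hoelder inequality in [y] gives the factor [N ^ (p - 1)]. After Tonelli's theorem
    the inner integral in [x] is at most [b ^ p], and integrating [|K|] supplies the missing factor
    [N]. *)
Lemma minkowski_integral (h : T1 -> T2 -> R) (K : T2 -> R) (D : set T1) (N b : R) :
  measurable_fun setT (fun z : T1 * T2 => h z.1 z.2) ->
  measurable_fun setT K -> measurable D ->
  \int[m2]_y `|K y|%:E = N%:E -> (0 <= b)%R ->
  (forall y, K y != 0%R -> Lnorm m1 p%:E (EFin \o ((h ^~ y) \_ D)) <= b%:E) ->
  \int[m1]_(x in D) (\int[m2]_y `|h x y * K y|%:E) `^ p <= ((N * b) `^ p)%:E.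
Proof.
move=> mh mK mD KN b0 hb.
have N0 : (0 <= N)%R by rewrite -lee_fin -KN integral_ge0// => x _; rewrite lee_fin.
have mh1 y : measurable_fun setT (h ^~ y).
  by have := measurableT_comp mh (measurable_pair2 y).
have mh2 x : measurable_fun setT (h x).
  by have := measurableT_comp mh (measurable_pair1 x).
have maK : measurable_fun setT (fun y => `|K y|%R) by exact: measurableT_comp.
(* The indicator of [D] is kept inside [F] so that Tonelli's theorem applies on the full product. *)
pose F (z : T1 * T2) := ((\1_D z.1 : R) * (`|h z.1 z.2| `^ p * `|K z.2|))%:E.
have F0 z : 0 <= F z by rewrite lee_fin !mulr_ge0// ?powR_ge0// indicE.
have mF : measurable_fun setT F.
  apply/measurable_EFinP; apply: measurable_funM.
    exact: (measurableT_comp (measurable_indic mD) measurable_fst).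
  apply: measurable_funM; last exact: (measurableT_comp maK measurable_snd).
  apply: (@measurableT_comp _ _ _ _ _ _ (@powR R ^~ p)) => //.
  exact: measurableT_comp.
have mFx : measurable_fun setT (fun x => \int[m2]_y F (x, y)).
  exact: measurable_fun_fubini_tonelli_F.
have mFy : measurable_fun setT (fun y => \int[m1]_x F (x, y)).
  exact: measurable_fun_fubini_tonelli_G.
have mhK := measurable_integral_powR mh mK.
apply: (@le_trans _ _ (\int[m1]_x ((N `^ (p - 1))%:E * \int[m2]_y F (x, y)))).
  rewrite integral_mkcond; apply: ge0_le_integral => //.
  - by move=> x _; rewrite /patch; case: ifP => // _; rewrite poweR_ge0.
  - by apply/(measurable_restrictT _ mD).1; exact: measurable_funTS.
  - exact: measurable_funeM.
  - move=> x _; rewrite /patch; case: ifPn => xD; last first.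
      by rewrite mule_ge0 ?integral_ge0// lee_fin powR_ge0.
    have -> : \int[m2]_y F (x, y) = \int[m2]_y (`|h x y| `^ p * `|K y|)%:E.
      by apply: eq_integral => y _; rewrite /F /= indicE xD mul1r.
    by rewrite -poweR_EFin -KN; exact: weighted_hoelder.
rewrite ge0_integralZl//; last 2 first.
- by move=> x _; exact: integral_ge0.
- by rewrite lee_fin powR_ge0.
rewrite (fubini_tonelli F mF F0).
apply: (@le_trans _ _ ((N `^ (p - 1))%:E * \int[m2]_y ((b `^ p)%:E * `|K y|%:E))).
  rewrite lee_wpmul2l ?lee_fin ?powR_ge0//; apply: ge0_le_integral => //.
  - by move=> y _; exact: integral_ge0.
  - by apply: measurable_funeM; exact/measurable_EFinP.
  - move=> y _; have [Ky0|Ky0] := eqVneq (K y) 0%R.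
      rewrite Ky0 normr0 mule0 integral0_eq// => x _.
      by rewrite /F /= Ky0 normr0 !mulr0.
    have -> : \int[m1]_x F (x, y) =
        `|K y|%:E * \int[m1]_x (`|((h ^~ y) \_ D) x| `^ p)%:E.
      rewrite -ge0_integralZl//; last first.
        apply: measurable_abs_powR; apply/(measurable_restrictT _ mD).1.
        exact: measurable_funTS.
      apply: eq_integral => x _; rewrite /F /= indicE /patch -EFinM.
      case: (x \in D); first by rewrite mul1r mulrC.
      by rewrite normr0 powR0 ?gt_eqF// mul0r mulr0.
    rewrite muleC lee_wpmul2r ?lee_fin// (integral_Lnorm m1 p1) -poweR_EFin.
    apply: (gt0_ler_poweR (ltW p0)); rewrite ?in_itv/= ?leey ?andbT ?lee_fin ?Lnorm_ge0//.
    exact: hb.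
rewrite ge0_integralZl//; last 2 first.
- exact/measurable_EFinP.
- by rewrite lee_fin powR_ge0.
rewrite KN -!EFinM lee_fin powRM// mulrCA mulrC.
have [->|N0'] := eqVneq N 0%R; first by rewrite !mulr0 !mul0r mulr_ge0// powR_ge0.
by rewrite -{2}(powRr1 N0) -powRD ?subrK// N0' implybT.
Qed.

End minkowski_integral.

(** * Convolution estimates in L^p of a subset *)

Section minkowski_convolution.
Context {R : realType} {n : nat}.
Local Notation V := 'rV[R]_n.+1.
Local Notation mu := (@lebesgue R n).
Variable p : R.
Hypothesis p1 : 1 <= p.
Local Notation NP f := (Lp_norm p%:E f%R).
Implicit Types (f g K : V -> R).

Let p0 : 0 < p. Proof. exact: lt_le_trans p1. Qed.

Lemma nice_Lp g : nice g -> Lp p%:E g.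
Proof.
move=> [mg _ [M gM] [r gr] _]; apply/LpP; split=> //.
have mc := measurable_indic (R := R) (D := setT) (measurable_cube (n := n) r).
apply: (@le_lt_trans _ _ (NP (fun x => M * \1_(cube r) x))).
  apply: (le_Lnorm mu p1 mg (measurable_funM (measurable_cst M) mc)) => x /=.
  rewrite indicE; case: (boolP (x \in cube r)) => [_|xr].
    by rewrite mulr1 (le_trans (gM x))// ler_norm.
  rewrite mulr0 gr// ltNge; apply: contra xr => xr.
  by rewrite inE.
rewrite /Lp_norm (Lnorm_scale mu p1 _ mc) lte_mul_pinfty//.
rewrite Lnorm_indic//; last exact: measurable_cube.
by rewrite poweR_lty// lebesgue_cube_lty.
Qed.

Lemma integrable_bounded_support K rho : continuous K ->
  (forall y : V, rho < `|y| -> K y = 0) -> mu.-integrable setT (EFin \o K).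
Proof.
move=> cK K0; have [M KM] := continuous_bounded_support cK K0.
have mK := continuous_measurable_rV cK.
apply/integrableP; split; first exact/measurable_EFinP.
apply: (@le_lt_trans _ _ (\int[mu]_(x in cube rho) M%:E)%E); last first.
  rewrite integral_cst; last exact: measurable_cube.
  by rewrite lte_mul_pinfty ?lebesgue_cube_lty// lee_fin (le_trans _ (KM 0)).
rewrite [leRHS]integral_mkcond; apply: (ge0_le_integral mu measurableT) => /=.
- by move=> x _; rewrite lee_fin.
- apply/measurable_EFinP.
  exact: (measurableT_comp (@normr_measurable R setT) mK).
- apply/(measurable_restrictT _ (measurable_cube rho)).1.
  exact: measurable_cst.
- move=> x _; rewrite /patch; case: ifPn => xr; first by rewrite lee_fin.
  rewrite K0 ?normr0// ltNge; apply: contra xr => xr.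
  by rewrite inE.
Qed.

(** The product measurability contained in [nice] is what allows Minkowski's inequality for
    [g (x - y)]. The bound is needed only where [K y != 0], hence for [|y| <= rho]. *)
Lemma nice_convolution_minkowski g K rho (D : set V) (N b : R) :
  nice g -> continuous K -> (forall y : V, rho < `|y| -> K y = 0) ->
  measurable D -> (\int[mu]_x `|K x|%:E = N%:E)%E -> 0 <= b ->
  (forall y : V, `|y| <= rho -> (NP ((fun x => g (x - y)) \_ D) <= b%:E)%E) ->
  (NP ((convolution g K) \_ D) <= (N * b)%:E)%E.
Proof.
move=> ng cK K0 mD KN b0 gb.
have [mg pg [M gM] _ _] := ng.
have gp := nice_Lp ng.
have N0 : 0 <= N by rewrite -lee_fin -KN integral_ge0// => x _; rewrite lee_fin.
have mK := continuous_measurable_rV cK.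
have [L KL] := continuous_bounded_support cK K0.
have [C C0 HC] := convolution_bound (n := n) p1 rho.
have iK x := (HC g K L gp mK KL K0 x).1.
rewrite /Lp_norm; apply: (Lnorm_le p1); first exact: mulr_ge0.
rewrite (integral_abs_powR_restrict mu p1).
have gbK (y : V) : K y != 0 -> (NP ((fun x => g (x - y)) \_ D) <= b%:E)%E.
  move=> Ky; apply: gb; rewrite leNgt; apply: contra Ky => /K0 ->.
  exact: eqxx.
have H := @minkowski_integral _ _ _ _ R mu mu p p1 (fun x y : V => g (x - y)) K D N b pg mK mD.
have H2 := H KN b0 gbK.
apply: le_trans H2.
have mc : measurable_fun setT (convolution g K).
  by apply: continuous_measurable_rV; exact: (convolution_continuous p1 gp cK K0).
apply: (ge0_le_integral mu mD).
- by move=> x _; rewrite lee_fin powR_ge0.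
- apply: measurable_funTS; exact: (measurable_abs_powR p mc).
- apply: measurable_funTS.
  exact: (@measurable_integral_powR _ _ _ _ R mu p (fun x y : V => g (x - y)) K pg mK).
- move=> x _; rewrite -poweR_EFin.
  apply: (gt0_ler_poweR (ltW p0)); rewrite ?in_itv/= ?leey ?andbT ?lee_fin//.
    by apply: integral_ge0 => y _; rewrite lee_fin.
  have iabs := integrable_abse (iK x).
  have := le_normr_Rintegral measurableT (iK x); rewrite -lee_fin => /le_trans; apply.
  rewrite /Rintegral fineK//; exact: (integrable_fin_num measurableT iabs).
Qed.

Lemma Lp_norm_subr f (y : V) : measurable_fun setT f ->
  NP (fun x => f (x - y)) = NP f.
Proof.
move=> mf; rewrite /Lp_norm !Lnorm_integral.
by rewrite -[in RHS](ge0_integral_subr y (measurable_abs_powR p mf)).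
Qed.

(** Restriction to [D] decreases the L^p norm and translation preserves it, so replacing [f] by an
    approximant costs [e] whatever [y] is. *)
Lemma Lp_norm_patch_subr_le f g (D : set V) (b e : R) (y : V) : measurable D ->
  measurable_fun setT f -> measurable_fun setT g ->
  (NP ((fun x => f (x - y)) \_ D) <= b%:E)%E -> (NP (f \- g) <= e%:E)%E ->
  (NP ((fun x => g (x - y)) \_ D) <= (b + e)%:E)%E.
Proof.
move=> mD mf mg fb fge.
have mfy := measurable_fun_subr y mf; have mgy := measurable_fun_subr y mg.
have -> : (fun x => g (x - y)) \_ D =
    ((fun x => f (x - y)) \_ D) \+ ((fun x => (g \- f) (x - y)) \_ D).
  apply/funext => x; rewrite /patch /=; case: ifP => _; last by rewrite addr0.
  by rewrite [RHS]addrC subrK.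
have mgf : measurable_fun setT (fun x : V => (g \- f) (x - y)).
  exact: (measurable_fun_subr y (measurable_funB mg mf)).
apply: (le_trans (minkowski_EFin mu (measurable_patch mD mfy) (measurable_patch mD mgf) p1)).
rewrite EFinD leeD//; apply: (le_trans (Lnorm_restrict_le mu p1 mD mgf)).
rewrite -[X in (X <= _)%E]/(NP (fun x => (g \- f) (x - y))).
by rewrite (Lp_norm_subr y (measurable_funB mg mf)) /Lp_norm Lnorm_subC.
Qed.

(* [f] is approximated in L^p by nice functions; the convolutions then converge
   pointwise and Fatou's lemma applies. *)
Lemma convolution_minkowski f K rho (D : set V) (N b : R) :
  Lp p%:E f -> continuous K -> (forall y : V, rho < `|y| -> K y = 0) ->
  measurable D -> (\int[mu]_x `|K x|%:E = N%:E)%E -> 0 <= b ->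
  (forall y : V, `|y| <= rho -> (NP ((fun x => f (x - y)) \_ D) <= b%:E)%E) ->
  (NP ((convolution f K) \_ D) <= (N * b)%:E)%E.
Proof.
move=> fp cK K0 mD KN b0 fb; have /LpP[mf _] := fp.
have N0 : 0 <= N by rewrite -lee_fin -KN integral_ge0// => x _; rewrite lee_fin.
have mK := continuous_measurable_rV cK.
have [L KL] := continuous_bounded_support cK K0.
have L0 : 0 <= L := le_trans (normr_ge0 _) (KL 0).
have [C C0 HC] := convolution_bound (n := n) p1 rho.
have mc h : Lp p%:E h -> measurable_fun setT (convolution h K).
  by move=> hp; apply: continuous_measurable_rV; exact: (convolution_continuous p1 hp cK K0).
apply/lee_addgt0Pr => e e0.
have N1 : 0 < N + 1 by rewrite ltr_wpDl.
(* An error [e'] in the bound [b] changes [N * b] by at most [e]; the added 1 covers [N = 0]. *)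
pose e' := e / (N + 1); have e'0 : 0 < e' by rewrite divr_gt0.
have /choice[g /all_and2[ng ge]] : forall k, exists g,
    nice g /\ (NP (f \- g) < (e' / k.+1%:R)%:E)%E.
  move=> k; have [g ng ge] := (Lp_approximable p1 fp).2 (e' / k.+1%:R) (divr_gt0 e'0 (ltr0Sn _ _)).
  by exists g.
have gp k := nice_Lp (ng k); have mg k : measurable_fun setT (g k) by have /LpP[] := gp k.
apply: (@le_trans _ _ (N * (b + e'))%:E); last first.
  rewrite -EFinD lee_fin mulrDr lerD2l /e' mulrA ler_pdivrMr// mulrC ler_wpM2l ?ltW//.
  by rewrite ltrDl.
apply: (@Lnorm_fatou _ _ _ mu p p1 (fun k => convolution (g k) K \_ D)).
- by rewrite mulr_ge0// addr_ge0// ltW.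
- by move=> k; exact: (measurable_patch mD (mc _ (gp k))).
- exact: (measurable_patch mD (mc _ fp)).
- move=> x; rewrite /patch; case: ifP => _; last exact: cvg_cst.
  (* By [convolution_bound] the difference at [x] is at most [L * C] times the L^p distance between
     [f] and [g k], which is below [e' / k.+1]. *)
  apply/cvgrPdist_le => r r0.
  have A0 : 0 <= L * C * e' := mulr_ge0 (mulr_ge0 L0 C0) (ltW e'0).
  have r1 : 0 < r / (L * C * e' + 1) by rewrite divr_gt0// ltr_wpDl.
  have [k0 _ Hk0] := near_infty_natSinv_lt (PosNum r1).
  exists k0 => // k /Hk0/= kr.
  have iC := (HC f K L fp mK KL K0 x).1; have iG := (HC (g k) K L (gp k) mK KL K0 x).1.
  rewrite -convolutionBl//.
  have fgp : Lp p%:E (f \- g k).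
    by apply/LpP; split; [exact: measurable_funB|rewrite (lt_trans (ge k))// ltry].
  apply: (le_trans (HC _ K L fgp mK KL K0 x).2).
  apply: (@le_trans _ _ (L * C * (e' / k.+1%:R))).
    rewrite ler_wpM2l ?mulr_ge0// -lee_fin fineK ?Lp_norm_fin_num//.
    exact: ltW.
  rewrite mulrA; apply: (@le_trans _ _ (L * C * e' * (r / (L * C * e' + 1)))).
    by rewrite ler_wpM2l// ltW.
  by rewrite mulrA ler_pdivrMr ?ltr_wpDl// mulrC ler_wpM2l ?lerDl// ltW.
move=> k; apply: (nice_convolution_minkowski (ng k) cK K0 mD KN).
  by rewrite addr_ge0// ltW.
move=> y yr; apply: (Lp_norm_patch_subr_le mD mf (mg k) (fb y yr)).
apply: (le_trans (ltW (ge k))); rewrite lee_fin ler_pdivrMr// ler_peMr ?(ltW e'0)//.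
by rewrite ler1n.
Qed.

End minkowski_convolution.

(** * Mollification *)

Section mollification.
Context {R : realType} {n : nat}.
Local Notation V := 'rV[R]_n.+1.
Local Notation mu := (@lebesgue R n).
Implicit Types (f g K phi : V -> R).

(** The one comparison of the two norms that is used: it encloses Euclidean balls in cubes. *)
Lemma enorm_ge_norm (x : V) : `|x| <= enorm x.
Proof.
apply: rV_norm_le; first exact: sqrtr_ge0.
move=> i; rewrite -sqrtr_sqr; apply: ler_wsqrtr.
by rewrite (bigD1 i)//= lerDl sumr_ge0// => j _; exact: sqr_ge0.
Qed.

Lemma closed_cube r : closed (cube r : set V).
Proof. exact: (compact_closed (@norm_hausdorff _ _) (@compact_cube _ _ r)). Qed.

Lemma eball_sub_cube (r : R) : eball (0 : V) r `<=` cube r.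
Proof.
move=> x; rewrite /eball /= subr0 => xr.
exact: (le_trans (enorm_ge_norm x) (ltW xr)).
Qed.

(** The closed cube contains the closure of the Euclidean ball. Later arguments use the support
    condition only in this sup norm form. *)
Lemma fsupp_sub_cube phi (r : R) : fsupp phi `<=` closure (eball 0 r) ->
  forall y : V, r < `|y| -> phi y = 0.
Proof.
move=> phir y yr; apply/eqP; apply: contraLR yr => phiy; rewrite -leNgt.
have : closure (cube r : set V) y.
  apply: (closure_subset (@eball_sub_cube r)); apply: phir.
  exact: subset_closure.
by rewrite -(closure_id _).1//; exact: closed_cube.
Qed.

Lemma dilate_support phi (r e : R) : 0 < e ->
  (forall y : V, r < `|y| -> phi y = 0) ->
  forall y : V, e * r < `|y| -> dilate phi e y = 0.
Proof.
move=> e0 phir y yr; rewrite /dilate phir ?mulr0// normrZ gtr0_norm ?invr_gt0//.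
by rewrite ltr_pdivlMl.
Qed.

Lemma dilate_Cinfty phi (e : R) : 0 < e -> Cinfty phi -> Cinfty (dilate phi e).
Proof.
by move=> e0 phiC k; apply: Ck_affine; [rewrite invr_eq0 gt_eqF|exact: phiC].
Qed.

Lemma integral_abs_dilate phi (e : R) : 0 < e -> measurable_fun setT phi ->
  (\int[mu]_y `|dilate phi e y|%:E = \int[mu]_y `|phi y|%:E)%E.
Proof.
move=> e0 mphi; have en0 : 0 < e ^+ n.+1 by rewrite exprn_gt0.
have mF : measurable_fun setT (fun y : V => `|phi y|%:E).
  by apply/measurable_EFinP; exact: (measurableT_comp (@normr_measurable R setT) mphi).
have ei : e^-1 != 0 by rewrite invr_eq0 gt_eqF.
have := ge0_integral_affine 0 ei mF (fun y => _).
rewrite gtr0_norm ?invr_gt0// exprVn invrK => H.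
transitivity (\int[mu]_y ((e ^- n.+1)%:E * `|phi (0 + e^-1 *: y)|%:E))%E.
  apply: eq_integral => y _.
  by rewrite add0r -EFinM /dilate normrM gtr0_norm// invr_gt0.
rewrite ge0_integralZl//; last 2 first.
- apply: (measurableT_comp mF); exact: measurable_affine.
- by rewrite lee_fin invr_ge0 ltW.
rewrite H ?muleA -?EFinM ?mulVf ?gt_eqF ?mul1e//.
Qed.

Lemma Rintegral_dilate phi (e : R) : 0 < e -> mu.-integrable setT (EFin \o phi) ->
  \int[mu]_y dilate phi e y = \int[mu]_y phi y.
Proof.
move=> e0 iphi; have en0 : 0 < e ^+ n.+1 by rewrite exprn_gt0.
have ei : e^-1 != 0 by rewrite invr_eq0 gt_eqF.
have := integral_affine 0 ei iphi; have := integrable_affine 0 ei iphi.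
rewrite gtr0_norm ?invr_gt0// exprVn invrK => i1 H.
rewrite /Rintegral; congr fine.
transitivity (\int[mu]_y ((e ^- n.+1)%:E * (EFin \o phi) (0 + e^-1 *: y)%R))%E.
  by apply: eq_integral => y _; rewrite add0r.
by rewrite integralZl// H muleA -EFinM mulVf ?gt_eqF// mul1e.
Qed.

Lemma convolution_sup_bound f K (x : V) (N c : R) :
  mu.-integrable setT (fun y : V => (f (x - y) * K y)%:E) ->
  measurable_fun setT K ->
  (\int[mu]_y `|K y|%:E = N%:E)%E -> 0 <= c ->
  (forall y, K y != 0 -> `|f (x - y)| <= c) -> `|convolution f K x| <= c * N.
Proof.
move=> iK mK KN c0 fc; have iabs := integrable_abse iK.
apply: (le_trans (le_normr_Rintegral measurableT iK)).
rewrite -lee_fin /Rintegral fineK; last exact: (integrable_fin_num measurableT iabs).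
have maK : measurable_fun setT (fun y : V => `|K y|%:E).
  by apply/measurable_EFinP; exact: (measurableT_comp (@normr_measurable R setT) mK).
rewrite EFinM -KN -ge0_integralZl//.
apply: (ge0_le_integral mu measurableT).
- by move=> y _; rewrite lee_fin.
- exact: measurable_int iabs.
- exact: measurable_funeM.
move=> y _; rewrite -EFinM lee_fin normrM.
have [->|Ky] := eqVneq (K y) 0; first by rewrite normr0 !mulr0.
by rewrite ler_wpM2r// fc.
Qed.

Lemma convolution_cst K (c : R) (x : V) : mu.-integrable setT (EFin \o K) ->
  \int[mu]_y K y = 1 -> convolution (cst c) K x = c.
Proof. by move=> iK K1; rewrite /convolution /= RintegralZl// K1 mulr1. Qed.

(** * Approximate identities in L^p *)

Section approximate_identity.
Variable phi : V -> R.
Hypothesis phi_C : continuous phi.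
Hypothesis phi_int : \int[mu]_x phi x = 1.
Hypothesis phi_supp : forall y : V, 1 < `|y| -> phi y = 0.
Let N := fine (\int[mu]_x `|phi x|%:E)%E.
Variable p : R.
Hypothesis p1 : 1 <= p.
Local Notation NP f := (Lp_norm p%:E f%R).

Lemma dilate_continuous (e : R) : continuous (dilate phi e).
Proof. exact: continuous_affine. Qed.

Lemma dilate_support1 (e : R) : 0 < e -> forall y : V, e < `|y| -> dilate phi e y = 0.
Proof. by move=> e0 y; rewrite -{1}[e]mulr1; exact: dilate_support. Qed.

Lemma integrable_dilate (e : R) : 0 < e -> mu.-integrable setT (EFin \o dilate phi e).
Proof.
move=> e0; exact: (integrable_bounded_support (@dilate_continuous e) (dilate_support1 e0)).
Qed.

Lemma dilate_abs_int (e : R) : 0 < e -> (\int[mu]_y `|dilate phi e y|%:E = N%:E)%E.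
Proof.
move=> e0; rewrite integral_abs_dilate//; last exact: continuous_measurable_rV.
have iphi := integrable_bounded_support phi_C phi_supp.
by rewrite /N fineK//; exact: (integrable_fin_num measurableT (integrable_abse iphi)).
Qed.

Lemma dilate_int (e : R) : 0 < e -> \int[mu]_y dilate phi e y = 1.
Proof.
move=> e0; rewrite Rintegral_dilate//.
exact: (integrable_bounded_support phi_C phi_supp).
Qed.

Lemma fine_integral_abs_ge0 : 0 <= N.
Proof. by apply: fine_ge0; apply: integral_ge0 => x _; rewrite lee_fin. Qed.

(** Since the dilated kernel has integral 1, the difference is the convolution of [g] minus the
    constant [g x], which is at most [c] on the support of the kernel. *)
Lemma nice_mollifier_pointwise g (x : V) (e c : R) : nice g -> 0 < e -> 0 <= c ->
  (forall y, `|y| <= e -> `|g (x - y) - g x| <= c) ->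
  `|convolution g (dilate phi e) x - g x| <= c * N.
Proof.
move=> ng e0 c0 gc; have gp := nice_Lp p1 ng.
have cK := @dilate_continuous e; have K0 := dilate_support1 e0.
have mK := continuous_measurable_rV cK.
have [L KL] := continuous_bounded_support cK K0.
have [C C0 HC] := convolution_bound (n := n) p1 e.
have iK := integrable_dilate e0.
have i1 := (HC g _ L gp mK KL K0 x).1.
have i2 : mu.-integrable setT (fun y : V => (cst (g x) (x - y) * dilate phi e y)%:E).
  exact: (integrableZl measurableT (g x) iK).
rewrite -[X in _ - X](convolution_cst (g x) x iK (dilate_int e0)).
rewrite -convolutionBl//; apply: convolution_sup_bound => //.
- have := integrableB measurableT i1 i2; apply: eq_integrable => // y _.
  by rewrite /= -EFinB mulrBl.
- exact: dilate_abs_int.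
move=> y Ky; apply: gc; rewrite leNgt; apply: contra Ky => /K0 ->.
exact: eqxx.
Qed.

(** Dominated convergence: at each continuity point of [g], hence almost everywhere, the
    mollifications converge. *)
Lemma nice_mollifier_cvg g : nice g -> forall r : R, 0 < r ->
  exists2 d : R, 0 < d & forall e, 0 < e -> e < d ->
    (NP (convolution g (dilate phi e) \- g) < r%:E)%E.
Proof.
move=> ng r r0; have gp := nice_Lp p1 ng; have [mg _ [M gM] [s gs] cg] := ng.
have M0 : 0 <= M := le_trans (normr_ge0 _) (gM 0).
(* Dominated convergence concerns sequences, so a failure of the claim is turned into a sequence
   [e k] tending to 0 along which the norm stays above [r]. *)
apply: contrapT => H.
have /choice[e He] : forall k : nat, exists e, [/\ 0 < e, e < k.+1%:R^-1 &
    (r%:E <= NP (convolution g (dilate phi e) \- g))%E].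
  move=> k; apply: contrapT => He; apply: H; exists k.+1%:R^-1.
    by rewrite invr_gt0.
  move=> e e0 ek; rewrite ltNge; apply/negP => re; apply: He.
  by exists e.
have e0 k : 0 < e k by have [] := He k.
pose u k := convolution g (dilate phi (e k)) \- g.
(* The dominating function: [g] varies by at most [M + M], and as [e k <= 1] nothing happens outside
   the support of [g] enlarged by 1. *)
pose h (x : V) := (M + M) * N * (\1_(cube (s + 1)) x : R).
have mu_ k : measurable_fun setT (u k).
  have cu := convolution_continuous p1 gp (@dilate_continuous (e k)) (dilate_support1 (e0 k)).
  exact: (measurable_funB (continuous_measurable_rV cu) mg).
have mind := measurable_indic (R := R) (D := setT) (measurable_cube (n := n) (s + 1)).
have mh : measurable_fun setT h by exact: (measurable_funM (measurable_cst _) mind).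
have hoo : (NP h < +oo)%E.
  rewrite /Lp_norm (Lnorm_scale mu p1 _ mind) lte_mul_pinfty//.
  rewrite (Lnorm_indic mu p1 (measurable_cube _)).
  by rewrite poweR_lty// lebesgue_cube_lty.
have e1 k : e k <= 1.
  have [_ ek _] := He k; rewrite (le_trans (ltW ek))// invf_le1// ler1n//.
have uh k x : `|u k x| <= h x.
  rewrite /h indicE; case: (boolP (x \in cube (s + 1))) => xs.
    rewrite mulr1; apply: nice_mollifier_pointwise => //; first exact: addr_ge0.
    by move=> y _; rewrite (le_trans (ler_normB _ _))// lerD.
  have xs' : s + 1 < `|x| by rewrite ltNge; apply: contra xs => xs; rewrite inE.
  (* Outside the enlarged cube the pointwise estimate applies with [c = 0], as [g] vanishes at [x]
     and at every [x - y] involved. *)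
  rewrite mulr0 -[leRHS](mul0r N); apply: nice_mollifier_pointwise => // y ye.
  have y1 := le_trans ye (e1 k).
  rewrite !gs ?subrr ?normr0//; first by apply: lt_trans xs'; rewrite ltrDl.
  have := ler_normD (x - y) y; rewrite subrK; lra.
have u0 : {ae mu, forall x, u k x @[k --> \oo] --> (0 : R)}.
  apply: filterS cg => x cgx; apply/cvgrPdist_le => q q0.
  have N1 : 0 < N + 1 by rewrite ltr_wpDl// fine_integral_abs_ge0.
  have q1 : 0 < q / (N + 1) by rewrite divr_gt0.
  have /cvgrPdist_le/(_ _ q1)/nbhs_ballP[d /= d0 Hd] := cgx.
  have [k0 _ Hk0] := near_infty_natSinv_lt (PosNum d0).
  exists k0 => // k /Hk0/= kd; rewrite sub0r normrN.
  apply: (@le_trans _ _ (q / (N + 1) * N)); last first.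
    by rewrite mulrAC ler_pdivrMr// ler_wpM2l ?(ltW q0)// lerDl.
  apply: nice_mollifier_pointwise => //; first exact: ltW.
  move=> y ye; rewrite distrC; apply: Hd; rewrite -ball_normE /ball_ /=.
  rewrite opprB addrC subrK; have [_ ek _] := He k.
  exact: (le_lt_trans ye (lt_trans ek kd)).
have [k _ Hk] := Lnorm_dominated_cvg p1 mu_ mh hoo uh u0 r0.
have [_ _] := He k; rewrite leNgt => /negP; apply; exact: (Hk k (leqnn k)).
Qed.

Lemma mollifier_cvg f : Lp p%:E f -> forall r : R, 0 < r ->
  exists2 d : R, 0 < d & forall e, 0 < e -> e < d ->
    (NP (convolution f (dilate phi e) \- f) < r%:E)%E.
Proof.
move=> fp r r0; have /LpP[mf _] := fp.
have N2 : 0 < N + 2 by rewrite ltr_wpDl// fine_integral_abs_ge0.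
(* The three errors are at most [N * r'] for the convolution of [f \- g], [r'] for mollifying [g]
   and [r'] for [g \- f]; they add up to [r]. *)
pose r' := r / (N + 2); have r'0 : 0 < r' by rewrite divr_gt0.
have [g ng fg] := (Lp_approximable p1 fp).2 _ r'0.
have gp := nice_Lp p1 ng; have /LpP[mg _] := gp.
have [d d0 Hd] := nice_mollifier_cvg ng r'0.
exists d => // e e0 ed.
have cK := @dilate_continuous e; have K0 := dilate_support1 e0.
have mK := continuous_measurable_rV cK.
have [L KL] := continuous_bounded_support cK K0.
have [C C0 HC] := convolution_bound (n := n) p1 e.
have mc h : Lp p%:E h -> measurable_fun setT (convolution h (dilate phi e)).
  by move=> hp; apply: continuous_measurable_rV; exact: (convolution_continuous p1 hp cK K0).
have fgp : Lp p%:E (f \- g).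
  by apply/LpP; split; [exact: measurable_funB|rewrite (lt_trans fg)// ltry].
have H1 : (NP (convolution (f \- g) (dilate phi e)) <= (N * r')%:E)%E.
  have pT h : h \_ setT = h :> (V -> R) by exact: patch_setT.
  rewrite -(pT (convolution _ _)).
  apply: (convolution_minkowski p1 fgp cK K0 (D := setT)) => //.
  - exact: dilate_abs_int.
  - exact: ltW.
  - move=> y _; rewrite pT.
    by rewrite (Lp_norm_subr p y (measurable_funB mf mg)) ltW.
have E : convolution f (dilate phi e) \- f = convolution (f \- g) (dilate phi e) \+
    ((convolution g (dilate phi e) \- g) \+ (g \- f)).
  apply/funext => x /=; rewrite convolutionBl; [ring| |].
  - exact: (HC f _ L fp mK KL K0 x).1.
  - exact: (HC g _ L gp mK KL K0 x).1.
have m1 : measurable_fun setT (convolution g (dilate phi e) \- g).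
  exact: (measurable_funB (mc _ gp) mg).
have m2 := measurable_funB mg mf.
rewrite E; apply: (le_lt_trans (minkowski_EFin mu (mc _ fgp) (measurable_funD m1 m2) p1)).
rewrite (_ : r = N * r' + (r' + r')); last by rewrite /r'; field; rewrite gt_eqF.
rewrite EFinD; apply: lee_ltD => //.
  by rewrite ge0_fin_numE ?Lnorm_ge0// (le_lt_trans H1)// ltry.
apply: (le_lt_trans (minkowski_EFin mu m1 m2 p1)).
rewrite EFinD lteD//; first exact: Hd.
by have := Lnorm_subC mu p g f; rewrite /Lp_norm => ->.
Qed.

End approximate_identity.

End mollification.

(** * Morrey spaces *)

Section cvg_at_right.
Context {R : realType}.
Local Open Scope ereal_scope.

Lemma cvg0_at_rightP (F : R -> \bar R) : (forall t, (0 < t)%R -> 0 <= F t) ->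
  F t @[t --> (0 : R)^'+] --> 0 <->
  forall e : R, (0 < e)%R -> exists2 d : R, (0 < d)%R &
    forall t, (0 < t)%R -> (t < d)%R -> F t <= e%:E.
Proof.
move=> F0; split=> [/fine_cvgP[fin /cvgrPdist_le H] e e0|H].
  have : \forall t \near (0 : R)^'+, F t <= e%:E.
    near=> t.
    have t0 : (0 < t)%R by near: t; exact: nbhs_right_gt.
    have Ff : F t \is a fin_num by near: t.
    rewrite -(fineK Ff) lee_fin; apply: le_trans (ler_norm _) _.
    by rewrite -normrN -sub0r; near: t; exact: H.
  move=> [d /= d0 Hd]; exists d => // t t0 td; apply: Hd => //=.
  by rewrite sub0r normrN gtr0_norm.
apply/fine_cvgP; split.
  have [d d0 Hd] := H 1%R ltr01; near=> t.
  have t0 : (0 < t)%R by near: t; exact: nbhs_right_gt.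
  have td : (t < d)%R by near: t; exact: nbhs_right_lt.
  by rewrite ge0_fin_numE ?F0// (le_lt_trans (Hd t t0 td))// ltry.
apply/cvgrPdist_le => e e0; have [d d0 Hd] := H e e0; near=> t.
have t0 : (0 < t)%R by near: t; exact: nbhs_right_gt.
have td : (t < d)%R by near: t; exact: nbhs_right_lt.
have Ff : F t \is a fin_num.
  by rewrite ge0_fin_numE ?F0// (le_lt_trans (Hd t t0 td))// ltry.
rewrite sub0r normrN /= ger0_norm ?fine_ge0 ?F0//.
by rewrite -lee_fin fineK// Hd.
Unshelve. all: by end_near. Qed.

End cvg_at_right.

Section morrey_spaces.
Context {R : realType} {n : nat}.
Local Notation V := 'rV[R]_n.+1.
Local Notation mu := (@lebesgue R n).
Implicit Types (f g K : V -> R) (rho : \bar R).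
Variable p : R.
Hypothesis p1 : 1 <= p.
Let p0 : 0 < p. Proof. exact: lt_le_trans p1. Qed.
Local Notation NP f := (Lp_norm p%:E f%R).
Variable w : R -> R.
Hypothesis w_ge0 : forall r : R, 0 < r -> 0 <= w r.
Local Notation S rho f := (morrey_sup rho w p%:E f%R).
Local Notation VM := (@vanishing_morrey R n w p%:E).
Local Notation LP := (@Lp R n p%:E).

Lemma measurable_eball (x : V) (r : R) : measurable (eball x r).
Proof.
have ms : measurable_fun setT (fun y : V => \sum_(i < n.+1) (y ord0 i - x ord0 i) ^+ 2).
  apply: measurable_sum => i; apply: measurable_funX.
  exact: (measurable_funB (measurable_coord i) (measurable_cst _)).
have me : measurable_fun setT (fun y : V => enorm (y - x)).
  rewrite (_ : (fun y : V => _) =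
      Num.sqrt \o (fun y : V => \sum_(i < n.+1) (y ord0 i - x ord0 i) ^+ 2)).
    apply: measurableT_comp => //; apply: continuous_measurable_fun; exact: sqrt_continuous.
  by apply/funext => y; rewrite /enorm /=; congr Num.sqrt; apply: eq_bigr => i _; rewrite !mxE.
rewrite (_ : eball x r = setT `&` (fun y : V => enorm (y - x)) @^-1` [set t | t < r]).
  by apply: me => //; rewrite -set_itvNyo; exact: measurable_itv.
by rewrite setTI.
Qed.

(** Comparison with the circumscribed cube; only the order of growth in [r] matters for the extra
    condition on [w]. *)
Lemma lebesgue_eball_le (x : V) (r : R) : 0 < r ->
  (mu (eball x r) <= ((2 * r) ^+ n.+1)%:E)%E.
Proof.
move=> r0; have N1 : 1 != 0 :> R by rewrite oner_eq0.
have := lebesgue_affine (- x) (cube r) N1.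
rewrite normr1 expr1n invr1 mul1e => E.
apply: (@le_trans _ _ (mu (cube r))); last exact: (lebesgue_cube_le (ltW r0)).
rewrite -E; apply: le_lebesgue_outer => y; rewrite /eball /= => yr.
rewrite /cube /= scale1r addrC; exact: (le_trans (enorm_ge_norm _) (ltW yr)).
Qed.

Lemma Lp_norm_eball_subr f (x y : V) (r : R) : measurable_fun setT f ->
  NP ((fun z => f (z - y)) \_ (eball x r)) = NP (f \_ (eball (x - y) r)).
Proof.
move=> mf; rewrite -(Lp_norm_subr p y (measurable_patch (measurable_eball _ _) mf)).
congr (Lp_norm _ _); apply/funext => z; rewrite /patch.
suff -> : (z - y \in eball (x - y) r) = (z \in eball x r) by [].
by apply/idP/idP; rewrite !inE /eball /= opprB addrA subrK.
Qed.

Lemma morrey_sup_ub f (x : V) (r : R) rho : 0 < r -> (r%:E < rho)%E ->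
  ((w r)%:E * Lp_norm_on (eball x r) p%:E f <= S rho f)%E.
Proof. by move=> r0 rr; apply: ereal_sup_ubound; exists x, r. Qed.

(** Some radius below [rho] has to exist: over an empty index set the supremum is [-oo]. *)
Lemma morrey_sup_ge0 f rho : (0 < rho)%E -> (0 <= S rho f)%E.
Proof.
move=> rho0; have [r r0 rr] : exists2 r : R, 0 < r & (r%:E < rho)%E.
  case: rho rho0 => [s|_|//]; last by exists 1; rewrite ?ltry.
  rewrite lte_fin => s0; exists (s / 2); first by rewrite divr_gt0.
  by rewrite lte_fin ltr_pdivrMr// ltr_pMr// ltr1n.
apply: le_trans (morrey_sup_ub f 0 r0 rr).
by rewrite mule_ge0 ?Lp_norm_ge0// lee_fin w_ge0.
Qed.

Lemma morrey_sup_le f rho (c : \bar R) :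
  (forall (x : V) (r : R), 0 < r -> (r%:E < rho)%E ->
    ((w r)%:E * Lp_norm_on (eball x r) p%:E f <= c)%E) -> (S rho f <= c)%E.
Proof. by move=> H; apply: ge_ereal_sup => _ [x [r [r0 rr ->]]]; exact: H. Qed.

Lemma le_morrey_sup f rho rho' : (rho <= rho')%E -> (S rho f <= S rho' f)%E.
Proof.
by move=> rr; apply: morrey_sup_le => x r r0 ?; apply: morrey_sup_ub => //; exact: lt_le_trans rr.
Qed.

Lemma le_morrey_supD f g rho : (0 < rho)%E -> measurable_fun setT f -> measurable_fun setT g ->
  (S rho (f \+ g) <= S rho f + S rho g)%E.
Proof.
move=> rho0 mf mg; apply: morrey_sup_le => x r r0 rr.
have mE := measurable_eball x r.
apply: (@le_trans _ _
  ((w r)%:E * (Lp_norm_on (eball x r) p%:E f + Lp_norm_on (eball x r) p%:E g))%E).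
  rewrite lee_wpmul2l ?lee_fin ?w_ge0//.
  rewrite /Lp_norm_on.
  have -> : (f \+ g) \_ (eball x r) = (f \_ (eball x r)) \+ (g \_ (eball x r)).
    by apply/funext => z; rewrite /patch /=; case: ifP => // _; rewrite addr0.
  exact: (minkowski_EFin mu (measurable_patch mE mf) (measurable_patch mE mg) p1).
rewrite ge0_muleDr ?Lp_norm_ge0// leeD//; exact: morrey_sup_ub.
Qed.

Lemma morrey_sup_opp f rho : S rho (fun x => - f x) = S rho f.
Proof.
congr ereal_sup; apply/seteqP; split=> z [x [r [r0 rr ->]]]; exists x, r; split=> //;
  congr (_ * _)%E; apply: abs_eq_Lnorm => y; rewrite /patch; case: ifP => _;
  by rewrite ?normrN ?normr0.
Qed.

Lemma le_morrey_supB f g rho : (0 < rho)%E -> measurable_fun setT f -> measurable_fun setT g ->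
  (S rho (f \- g) <= S rho f + S rho g)%E.
Proof.
move=> rho0 mf mg; rewrite -(morrey_sup_opp g).
exact: (le_morrey_supD rho0 mf (measurableT_comp (@oppr_measurable R setT) mg)).
Qed.

(** A translate of [f] on a ball has the norm of [f] on a ball of the same radius at another centre.
    One bound therefore serves all translates, and radii below [rho] stay below [rho]. *)
Lemma morrey_sup_convolution_le f K (s N : R) rho : (0 < rho)%E ->
  LP f -> continuous K -> (forall y : V, s < `|y| -> K y = 0) ->
  (\int[mu]_x `|K x|%:E = N%:E)%E -> (S rho f < +oo)%E ->
  (S rho (convolution f K) <= N%:E * S rho f)%E.
Proof.
move=> rho0 fp cK K0 KN foo; have /LpP[mf _] := fp.
have N0 : 0 <= N by rewrite -lee_fin -KN integral_ge0// => x _; rewrite lee_fin.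
have S0 := morrey_sup_ge0 f rho0.
have Sfin : S rho f \is a fin_num by rewrite ge0_fin_numE.
apply: morrey_sup_le => x r r0 rr.
have [wr0|wr0] := eqVneq (w r) 0; first by rewrite wr0 mul0e mule_ge0// lee_fin.
have wr : 0 < w r by rewrite lt0r wr0 w_ge0.
(* [b] bounds the L^p norm of [f] on every ball of radius [r]; the case of zero weight is settled
   first so that the division makes sense. *)
pose b := fine (S rho f) / w r.
have b0 : 0 <= b by rewrite divr_ge0 ?fine_ge0// ltW.
have H := convolution_minkowski p1 fp cK K0 (measurable_eball x r) KN b0.
apply: (@le_trans _ _ ((w r)%:E * (N * b)%:E)%E).
  apply: lee_wpmul2l; first by rewrite lee_fin ltW.
  apply: H => y _.
  rewrite (Lp_norm_eball_subr _ _ _ mf) /b EFinM fineK//.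
  rewrite -lee_pdivrMr ?invr_gt0// invrK muleC; exact: morrey_sup_ub.
rewrite -EFinM -[X in (_ <= _ * X)%E](fineK Sfin) -EFinM lee_fin /b mulrCA.
by rewrite [w r * _]mulrCA mulfV// mulr1.
Qed.

Hypothesis w_bound : forall rho : R, 0 < rho ->
  (ereal_sup [set (w r)%:E | r in [set r : R | (rho <= r)%R]] < +oo)%E.

Lemma morrey_norm_le (d : R) : 0 < d -> exists2 C : R, 0 <= C &
  forall f, measurable_fun setT f ->
    (morrey_norm w p%:E f <= maxe (S d%:E f) (C%:E * NP f))%E.
Proof.
move=> d0; have Woo := w_bound d0.
have W0 : (0 <= ereal_sup [set (w r)%:E | r in [set r : R | (d <= r)%R]])%E.
  apply: (@le_trans _ _ (w d)%:E); first by rewrite lee_fin w_ge0.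
  by apply: ereal_sup_ubound; exists d => /=.
have Wfin : ereal_sup [set (w r)%:E | r in [set r : R | (d <= r)%R]] \is a fin_num.
  by rewrite ge0_fin_numE.
exists (fine (ereal_sup [set (w r)%:E | r in [set r : R | (d <= r)%R]])); first exact: fine_ge0.
move=> f mf; apply: morrey_sup_le => x r r0 _; rewrite le_max.
have [rd|rd] := ltP r d; first by rewrite morrey_sup_ub.
apply/orP; right; rewrite fineK//; apply: lee_pmul.
- by rewrite lee_fin w_ge0.
- exact: Lp_norm_ge0.
- by apply: ereal_sup_ubound; exists r.
- exact: (Lnorm_restrict_le mu p1 (measurable_eball x r) mf).
Qed.

(** The seminorm is nondecreasing in the radius, so one good radius for each [e] is equivalent to
    the limit. *)
Lemma vanishing_morreyP f : VM f <-> morrey w p%:E f /\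
  forall e : R, 0 < e -> exists2 d : R, 0 < d & (S d%:E f <= e%:E)%E.
Proof.
have S0 (t : R) : 0 < t -> (0 <= S t%:E f)%E by move=> t0; apply: morrey_sup_ge0; rewrite lte_fin.
rewrite /vanishing_morrey /=; split=> -[fM H]; split=> //.
  move=> e e0; have [d d0 Hd] := (cvg0_at_rightP S0).1 H e e0.
  exists (d / 2); first by rewrite divr_gt0.
  by apply: Hd; rewrite ?divr_gt0// ltr_pdivrMr// ltr_pMr// ltr1n.
apply/(cvg0_at_rightP S0) => e /H[d d0 Hd]; exists d => // t t0 td.
by apply: le_trans Hd; apply: le_morrey_sup; rewrite lee_fin ltW.
Qed.

Lemma closure_morrey_LpS (A B : set (V -> R)) : A `<=` B ->
  closure_morrey_Lp w p%:E A `<=` closure_morrey_Lp w p%:E B.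
Proof.
move=> AB f [fX H]; split=> // e /H[g Ag fg]; exists g => //; exact: AB.
Qed.

(** The local seminorm of [f] is at most the full Morrey norm of [f \- g] plus the local seminorm of
    [g]; [g] is chosen first, then the radius [d]. *)
Lemma closure_sub_vanishing (A : set (V -> R)) : A `<=` VM ->
  closure_morrey_Lp w p%:E A `<=` VM `&` LP.
Proof.
move=> AM f [[fM fp] H]; split=> //; apply/vanishing_morreyP; split=> // e e0.
have e2 : 0 < e / 2 by rewrite divr_gt0.
have [g /AM/vanishing_morreyP[[mg _] Hg]] := H _ e2.
rewrite gt_max => /andP[fg _]; have [d d0 Hd] := Hg _ e2; exists d => //.
have /LpP[mf _] := fp.
rewrite (_ : f = (f \- g) \+ g); last by apply/funext => x /=; rewrite subrK.
apply: (le_trans (le_morrey_supD _ (measurable_funB mf mg) mg)); first by rewrite lte_fin.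
rewrite (splitr e) EFinD leeD//; apply: le_trans (ltW fg).
by apply: le_morrey_sup; rewrite leey.
Qed.

(** * Mollification in the Morrey norm *)

Section mollifier.
Variable phi : V -> R.
Hypothesis phi_C : Cinfty phi.
Hypothesis phi_int : \int[mu]_x phi x = 1.
Hypothesis phi_supp : forall y : V, 1 < `|y| -> phi y = 0.

Let cphi : continuous phi. Proof. exact: (Ck_continuous (phi_C 0)). Qed.

Lemma mollifier_smooth f (e : R) : (VM `&` LP) f -> 0 < e ->
  (VM `&` LP `&` @Cinfty R n `&` @C0ub R n) (convolution f (dilate phi e)).
Proof.
move=> [/vanishing_morreyP[[mf fM] f0] fp] e0.
have cK := dilate_continuous cphi (e := e); have K0 := dilate_support1 phi_supp e0.
have KN := dilate_abs_int cphi phi_supp e0; set N := fine _ in KN.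
have N0 := fine_integral_abs_ge0 phi.
have mc : measurable_fun setT (convolution f (dilate phi e)).
  by apply: continuous_measurable_rV; exact: (convolution_continuous p1 fp cK K0).
have y0 : (0 < +oo :> \bar R)%E by [].
split; last exact: (convolution_C0ub p1 fp cK K0).
split; last first.
  by move=> k; apply: (convolution_Ck p1 fp _ K0); exact: dilate_Cinfty.
split; last first.
  apply/LpP; split=> //.
  (* Membership in L^p is the Minkowski estimate with the whole space as [D]. *)
  have pT h : h \_ setT = h :> (V -> R) by exact: patch_setT.
  rewrite -(pT (convolution _ _)).
  have b0 : 0 <= fine (NP f) by rewrite fine_ge0// Lp_norm_ge0.
  have H := convolution_minkowski p1 fp cK K0 (D := setT) measurableT KN b0.
  apply: (le_lt_trans (H _)); last by rewrite ltry.
  by move=> y _; rewrite pT (Lp_norm_subr p y mf) fineK// Lp_norm_fin_num.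
apply/vanishing_morreyP; split.
  split=> //; apply: (le_lt_trans (morrey_sup_convolution_le y0 fp cK K0 KN fM)).
  by rewrite lte_mul_pinfty ?lee_fin.
move=> r r0; have N1 : 0 < N + 1 by rewrite ltr_wpDl.
have [d d0 Hd] := f0 _ (divr_gt0 r0 N1); exists d => //.
have d0' : (0 < d%:E)%E by rewrite lte_fin.
have doo : (S d%:E f < +oo)%E by rewrite (le_lt_trans Hd)// ltry.
apply: (le_trans (morrey_sup_convolution_le d0' fp cK K0 KN doo)).
apply: (@le_trans _ _ (N%:E * (r / (N + 1))%:E)%E); first by rewrite lee_wpmul2l ?lee_fin.
by rewrite -EFinM lee_fin mulrA ler_pdivrMr// mulrC ler_wpM2l ?(ltW r0)// lerDl.
Qed.

Lemma mollifier_morrey_cvg f : (VM `&` LP) f ->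
  morrey_Lp_norm w p%:E (convolution f (dilate phi e) \- f)
    @[e --> (0 : R)^'+] --> 0%E.
Proof.
move=> [/vanishing_morreyP[[mf fM] f0] fp].
apply/cvg0_at_rightP => [t t0|r r0].
  by rewrite /morrey_Lp_norm le_max Lp_norm_ge0 orbT.
pose N := fine (\int[mu]_x `|phi x|%:E)%E; have N0 : 0 <= N := fine_integral_abs_ge0 phi.
have N1 : 0 < N + 1 by rewrite ltr_wpDl.
(* The local seminorm of the difference is at most [N + 1] times that of [f], whence the divisor;
   this holds for every [e], so [d] is fixed before [e]. *)
have [d d0 Hd] := f0 _ (divr_gt0 r0 N1).
have d0' : (0 < d%:E)%E by rewrite lte_fin.
have doo : (S d%:E f < +oo)%E by rewrite (le_lt_trans Hd)// ltry.
have [C C0 HC] := morrey_norm_le d0.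
have C1 : 0 < C + 1 by rewrite ltr_wpDl.
(* [C] bounds the weight on radii from [d] on and depends on [d]; only now is the range of [e]
   restricted, to an L^p error of [r / (C + 1)]. *)
have [t t0 Ht] := mollifier_cvg cphi phi_int phi_supp p1 fp (divr_gt0 r0 C1).
exists t => // e e0 et; have fe := Ht e e0 et.
have cK := dilate_continuous cphi (e := e); have K0 := dilate_support1 phi_supp e0.
have KN := dilate_abs_int cphi phi_supp e0.
have mc : measurable_fun setT (convolution f (dilate phi e)).
  by apply: continuous_measurable_rV; exact: (convolution_continuous p1 fp cK K0).
have rC : r / (C + 1) <= r by rewrite ler_pdivrMr// ler_peMr ?(ltW r0)// lerDr.
rewrite /morrey_Lp_norm ge_max; apply/andP; split; last first.
  by rewrite (le_trans (ltW fe))// lee_fin.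
apply: (le_trans (HC _ (measurable_funB mc mf))).
rewrite ge_max; apply/andP; split.
  apply: (le_trans (le_morrey_supB d0' mc mf)).
  apply: (@le_trans _ _ (N%:E * S d%:E f + S d%:E f)%E).
    by rewrite leeD2r//; exact: (morrey_sup_convolution_le d0' fp cK K0 KN doo).
  apply: (@le_trans _ _ (N%:E * (r / (N + 1))%:E + (r / (N + 1))%:E)%E).
    by rewrite leeD// lee_wpmul2l ?lee_fin.
  by rewrite -EFinM -EFinD lee_fin -{2}[r / (N + 1)]mul1r -mulrDl mulrC divfK// gt_eqF.
apply: (@le_trans _ _ (C%:E * (r / (C + 1))%:E)%E).
  by rewrite lee_wpmul2l ?lee_fin// ltW.
by rewrite -EFinM lee_fin mulrA ler_pdivrMr// mulrC ler_wpM2l ?(ltW r0)// lerDl.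
Qed.

Lemma closure_smooth_vanishing :
  closure_morrey_Lp w p%:E (VM `&` LP `&` @Cinfty R n `&` @C0ub R n) = VM `&` LP.
Proof.
apply/seteqP; split; first by apply: closure_sub_vanishing => f [[[]]].
move=> f fMp; have [fM fp] := fMp; split; first by split=> //; case: fM.
move=> e e0; have H := mollifier_morrey_cvg fMp.
have nn t : 0 < t -> (0 <= morrey_Lp_norm w p%:E (convolution f (dilate phi t) \- f)%R)%E.
  by move=> _; rewrite /morrey_Lp_norm le_max Lp_norm_ge0 orbT.
have e2 : 0 < e / 2 by rewrite divr_gt0.
have [d d0 Hd] := (cvg0_at_rightP nn).1 H _ e2.
have d2 : 0 < d / 2 by rewrite divr_gt0.
exists (convolution f (dilate phi (d / 2))); first exact: mollifier_smooth.
apply: (@le_lt_trans _ _ (e / 2)%:E); last first.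
  by rewrite lte_fin ltr_pdivrMr// ltr_pMr// ltr1n.
apply: le_trans (Hd (d / 2) d2 _); last first.
  by rewrite ltr_pdivrMr// ltr_pMr// ltr1n.
rewrite /morrey_Lp_norm /morrey_norm.
have E : (f \- convolution f (dilate phi (d / 2))) =
   (fun x => - (convolution f (dilate phi (d / 2)) \- f) x).
  by apply/funext => x /=; rewrite opprB.
rewrite [in X in maxe X _]E morrey_sup_opp.
have := Lnorm_subC mu p f (convolution f (dilate phi (d / 2))).
by rewrite /Lp_norm => ->.
Qed.

End mollifier.

(** An almost everywhere bound [M] gives [M * (2 * r) ^ (n.+1 / p)] on a ball of radius [r];
    multiplied by [w r], this is a constant times the quantity assumed to tend to 0. *)
Lemma Lp_oo_vanishing f :
  ereal_sup [set (w r * r `^ (n.+1%:R / p))%:E | r in [set r : R | (0 < r <= rho)%R]]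
    @[rho --> (0 : R)^'+] --> 0%E ->
  (morrey w p%:E `&` LP `&` Lp +oo%E) f -> VM f.
Proof.
move=> wr [[fM fp] foo]; apply/vanishing_morreyP; split=> // e e0.
have /LpP[mf _] := fp.
have [M Mge0 fM'] : exists2 M : R, 0 <= M & {ae mu, forall x, `|f x| <= M}.
  move: foo; rewrite /Lp /= inE => /andP[_]; rewrite inE /= /finite_norm unlock /=.
  case: ifPn => [_ foo|mu0 _].
    have [M HM] := ess_supr_bounded (f := fun x : V => `|f x|) foo.
    exists (Num.max 0 M); first by rewrite le_max lexx.
    by apply: filterS HM => x fM'; rewrite le_max [X in _ || X]fM' orbT.
  (* The L^oo norm is an essential supremum only when [0 < mu setT]; otherwise the whole space is
     negligible and any bound holds almost everywhere. *)
  exists 0 => //; exists setT; split=> //.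
  by apply/eqP; rewrite eq_le measure_ge0 andbT leNgt.
have c0 : 0 <= 2 `^ (n.+1%:R / p) :> R by exact: powR_ge0.
have A0 : 0 < M * 2 `^ (n.+1%:R / p) + 1 by rewrite ltr_wpDl// mulr_ge0.
have nn (t : R) : 0 < t -> (0 <= ereal_sup [set (w r * r `^ (n.+1%:R / p))%:E |
     r in [set r : R | (0 < r <= t)%R]])%E.
  move=> t0; apply: (@le_trans _ _ (w t * t `^ (n.+1%:R / p))%:E).
    by rewrite lee_fin mulr_ge0 ?powR_ge0// w_ge0.
  by apply: ereal_sup_ubound; exists t => //=; rewrite t0 lexx.
have [d d0 Hd] := (cvg0_at_rightP nn).1 wr _ (divr_gt0 e0 A0).
exists d => //; apply: morrey_sup_le => x r r0; rewrite lte_fin => rd.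
have := Hd r r0 rd; move=> /(le_trans _) H.
have {}H : w r * r `^ (n.+1%:R / p) <= e / (M * 2 `^ (n.+1%:R / p) + 1).
  by rewrite -lee_fin; apply: H; apply: ereal_sup_ubound; exists r => //=; rewrite r0 lexx.
have fB : (Lp_norm_on (eball x r) p%:E f <= (M * (2 * r) `^ (n.+1%:R / p))%:E)%E.
  have mB := measurable_eball x r.
  have mi := measurable_indic (R := R) (D := setT) mB.
  apply: (@le_trans _ _ (NP (fun z => M * \1_(eball x r) z))).
    apply: (le_Lnorm_ae p1 (measurable_patch mB mf) (measurable_funM (measurable_cst M) mi)).
    apply: filterS fM' => z fz; rewrite /patch /= indicE; case: ifP => _.
      by rewrite mulr1 (le_trans fz)// ler_norm.
    by rewrite normr0.
  rewrite /Lp_norm (Lnorm_scale mu p1 _ mi) (Lnorm_indic mu p1 mB) ger0_norm// EFinM.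
  rewrite lee_wpmul2l ?lee_fin//.
  have r20 : 0 <= 2 * r by rewrite mulr_ge0// ltW.
  rewrite powRrM powR_mulrn// -poweR_EFin.
  have p0' : 0 <= p^-1 by rewrite invr_ge0 ltW.
  apply: (gt0_ler_poweR p0'); rewrite ?in_itv/= ?leey ?andbT ?lee_fin ?exprn_ge0//.
  exact: lebesgue_eball_le.
apply: (@le_trans _ _ ((w r)%:E * (M * (2 * r) `^ (n.+1%:R / p))%:E)%E).
  by rewrite lee_wpmul2l// lee_fin w_ge0.
rewrite -EFinM lee_fin powRM ?(ltW r0)//.
apply: (@le_trans _ _ ((M * 2 `^ (n.+1%:R / p)) * (e / (M * 2 `^ (n.+1%:R / p) + 1)))).
  apply: le_trans (ler_wpM2l _ H); last by rewrite mulr_ge0.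
  by rewrite le_eqVlt; apply/predU1P; left; ring.
by rewrite mulrA ler_pdivrMr// mulrC ler_wpM2l ?(ltW e0)// lerDl.
Qed.

Lemma C0ub_Lp_oo f : measurable_fun setT f -> C0ub f -> Lp +oo%E f.
Proof.
move=> mf [[M [Mreal HM]] _]; rewrite /Lp /= inE; apply/andP; split.
  by rewrite inE.
rewrite inE /= /finite_norm unlock /=; case: ifPn => // _.
apply: (@le_lt_trans _ _ (M + 1)%:E); last exact: ltry.
apply: ess_sup_ler => x; rewrite lee_fin; apply: HM => //.
by rewrite ltrDl.
Qed.

End morrey_spaces.

Theorem theorem14p1 (R : realType) (n : nat)
  (phi : 'rV[R]_n.+1 -> R)
  (phi_Cc : Cc_infty phi)
  (phi_int : \int[lebesgue]_x phi x = 1)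
  (phi_supp : fsupp phi `<=` closure (eball 0 1))
  (w : R -> R)
  (w_ge0 : forall r : R, 0 < r -> 0 <= w r)
  (w_neq0 : exists2 r0 : R, 0 < r0 & w r0 != 0) :
  (* (i) *)
  (forall p : R, 1 <= p ->
    (forall rho : R, 0 < rho ->
      (ereal_sup [set (w r)%:E | r in [set r : R | (rho <= r)%R]] < +oo)%E) ->
    forall f : 'rV[R]_n.+1 -> R,
      (vanishing_morrey w p%:E `&` Lp p%:E) f ->
      (forall e : R, 0 < e ->
        (vanishing_morrey w p%:E `&` Lp p%:E `&` Cinfty `&` C0ub)
          (convolution f (dilate phi e))) /\
      (morrey_Lp_norm w p%:E (convolution f (dilate phi e) \- f)
        @[e --> (0 : R)^'+] --> 0%E)) /\
  (* (ii) *)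
  (forall p : R, 1 <= p ->
    (forall rho : R, 0 < rho ->
      (ereal_sup [set (w r)%:E | r in [set r : R | (rho <= r)%R]] < +oo)%E) ->
    (closure_morrey_Lp w p%:E
       (vanishing_morrey w p%:E `&` Lp p%:E `&` Cinfty `&` C0ub) =
     vanishing_morrey w p%:E `&` Lp p%:E :> set ('rV[R]_n.+1 -> R)) /\
    (ereal_sup [set (w r * r `^ (n.+1%:R / p))%:E |
                r in [set r : R | (0 < r <= rho)%R]]
       @[rho --> (0 : R)^'+] --> 0%E ->
     [/\ closure_morrey_Lp w p%:E
           (vanishing_morrey w p%:E `&` Lp p%:E `&` Cinfty `&` C0ub) =
         closure_morrey_Lp w p%:E
           (morrey w p%:E `&` Lp p%:E `&` Cinfty `&` C0ub)
           :> set ('rV[R]_n.+1 -> R),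
         closure_morrey_Lp w p%:E
           (morrey w p%:E `&` Lp p%:E `&` Cinfty `&` C0ub) =
         closure_morrey_Lp w p%:E
           (morrey w p%:E `&` Lp p%:E `&` Lp +oo%E)
           :> set ('rV[R]_n.+1 -> R) &
         closure_morrey_Lp w p%:E
           (morrey w p%:E `&` Lp p%:E `&` Lp +oo%E) =
         vanishing_morrey w p%:E `&` Lp p%:E
           :> set ('rV[R]_n.+1 -> R)])).
Proof.
have [phi_C _] := phi_Cc.
have phi_supp1 (y : 'rV[R]_n.+1) : 1 < `|y| -> phi y = 0.
  exact: (fsupp_sub_cube phi_supp).
split=> p p1 wb.
  move=> f fMp; split=> [e e0|].
    exact: (mollifier_smooth p1 w_ge0 phi_C phi_supp1 fMp e0).
  exact: (mollifier_morrey_cvg p1 w_ge0 wb phi_C phi_int phi_supp1 fMp).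
have clS := closure_smooth_vanishing p1 w_ge0 wb phi_C phi_int phi_supp1.
split=> // wr.
(* Sandwich principle: every set between the smooth vanishing functions and the vanishing ones has
   the same closure. The extra condition on [w] places both remaining sets in this range. *)
have incl A : vanishing_morrey w p%:E `&` Lp p%:E `&` @Cinfty R n `&` @C0ub R n `<=` A ->
    A `<=` vanishing_morrey w p%:E ->
    closure_morrey_Lp w p%:E A = vanishing_morrey w p%:E `&` Lp p%:E.
  move=> sA AM; apply/seteqP; split; first exact: (closure_sub_vanishing p1 w_ge0 AM).
  by rewrite -clS; exact: closure_morrey_LpS.
have M0M : @vanishing_morrey R n w p%:E `<=` morrey w p%:E by move=> f [].
have smooth_oo : morrey w p%:E `&` Lp p%:E `&` @Cinfty R n `&` @C0ub R n `<=`
    morrey w p%:E `&` Lp p%:E `&` Lp +oo%E.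
  by move=> f [[fMp _] fub]; split=> //; apply: C0ub_Lp_oo => //; case: fMp => -[].
have van_smooth : vanishing_morrey w p%:E `&` Lp p%:E `&` @Cinfty R n `&` @C0ub R n `<=`
    morrey w p%:E `&` Lp p%:E `&` @Cinfty R n `&` @C0ub R n.
  by do 3! apply: setSI.
have oo_van : morrey w p%:E `&` Lp p%:E `&` @Lp R n +oo%E `<=` vanishing_morrey w p%:E.
  by move=> f; exact: (Lp_oo_vanishing p1 w_ge0 wr).
have cl2 := incl _ van_smooth (subset_trans smooth_oo oo_van).
have cl3 := incl _ (subset_trans van_smooth smooth_oo) oo_van.
by rewrite clS cl2 cl3.
Qed.
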